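(* Assume $f_j'(u)+1\ne0$ and $f_j''(u)\neq0$ for all $u\in\mathbb R$ and all $1\le j\le k$. For an integer $\ell\ge1$ define the function on $\mathcal M_F$ $$\beta_\ell=\sum_{j=1}^k\frac{f_j^{(\ell+1)}(u_j)\,\bigl(1+f_j'(u_j)\bigr)^{\ell-1}}{\bigl(f_j''(u_j)\bigr)^{\ell}}.$$ (1) $\beta_\ell$ is an $\ell$-model invariant: if $F'$ is another $k$-tuple of functions satisfying the same hypotheses (with the same signs $\varepsilon_i$), $P\in\mathcal M_F$, $Q\in\mathcal M_{F'}$, and $\Phi:T_P\mathcal M_F\to T_Q\mathcal M_{F'}$ is a linear isometry with $\Phi^*(\nabla^iR)_Q=(\nabla^iR)_P$ for $0\le i\le\ell$, then $\beta_\ell^{F}(P)=\beta_\ell^{F'}(Q)$. (2) If $\mathcal M_F$ is $\ell$-curvature homogeneous, then $\beta_p$ is constant on $\mathcal M_F$ for every $p=1,\dots,\ell$. (3) If $\mathcal M_F$ is locally homogeneous, then $\beta_\ell$ is constant for every $\ell\ge1$.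
   Context: Fix an integer $k\ge 1$ and signs $\varepsilon_1,\dots,\varepsilon_k\in\{\pm1\}$. Let $f_1,\dots,f_k:\mathbb R\to\mathbb R$ be smooth, $F=(f_1,\dots,f_k)$. On $\mathbb R^{3k+2}$ with coordinates $(u_0,\dots,u_k,v_0,\dots,v_k,s_1,\dots,s_k)$ let $g_F$ be the symmetric metric whose only nonzero components on coordinate vector fields are (up to symmetry), for $1\le i\le k$ and $0\le i',j\le k$: $g_F(\partial_{u_0},\partial_{u_i})=2f_i(u_i)s_i$, $g_F(\partial_{u_i},\partial_{u_i})=-2u_0s_i$, $g_F(\partial_{u_{i'}},\partial_{v_j})=\delta_{i'j}$, $g_F(\partial_{s_i},\partial_{s_i})=\varepsilon_i$; $\mathcal M_F=(\mathbb R^{3k+2},g_F)$. $\nabla$ is the Levi-Civita connection, $R(X,Y,Z,W)=g_F(\nabla_X\nabla_YZ-\nabla_Y\nabla_XZ-\nabla_{[X,Y]}Z,W)$, $\nabla^0R=R$ and $\nabla^\ell R(X_1,\dots,X_4;Y_1,\dots,Y_\ell)=(\nabla_{Y_\ell}\nabla^{\ell-1}R)(X_1,\dots,X_4;Y_1,\dots,Y_{\ell-1})$. A pseudo-Riemannian manifold $(M,g)$ is $\ell$-curvature homogeneous if for all $P,Q\in M$ there is a linear isometry $\Phi:T_PM\to T_QM$ with $\Phi^*(\nabla^iR)_Q=(\nabla^iR)_P$ for $i=0,\dots,\ell$. It is locally homogeneous if for all $P,Q$ there is an isometry between neighborhoods of $P$ and $Q$ sending $P$ to $Q$. *)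

(* Defs.v *)
From Stdlib Require Import Reals.
From Coquelicot Require Import Coquelicot.
From mathcomp Require Import all_boot all_algebra.
From mathcomp Require Import Rstruct.

Set Implicit Arguments.
Unset Strict Implicit.
Unset Printing Implicit Defensive.

Local Open Scope R_scope.

(* points of R^N / tangent vectors in the coordinate frame *)
Definition vec (N : nat) := 'I_N -> R.

Definition rsum (n : nat) (h : 'I_n -> R) : R := \big[Rplus/0]_(i < n) h i.

Definition upd N (x : vec N) (a : 'I_N) (t : R) : vec N :=
  fun i => if i == a then t else x i.

Definition pd N (h : vec N -> R) (a : 'I_N) (x : vec N) : R :=
  Derive (fun t => h (upd x a t)) (x a).

Definition ipd N (h : vec N -> R) (as_ : seq 'I_N) : vec N -> R :=
  foldr (fun a h' => pd h' a) h as_.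

Definition box_ball N (x : vec N) (d : R) : vec N -> Prop :=
  fun y => forall i, Rabs (y i - x i) < d.

Definition open_set N (U : vec N -> Prop) : Prop :=
  forall x, U x -> exists d, 0 < d /\ (forall y, box_ball x d y -> U y).

Definition cont_at N (h : vec N -> R) (x : vec N) : Prop :=
  forall e, 0 < e -> exists d, 0 < d /\
    (forall y, box_ball x d y -> Rabs (h y - h x) < e).

Definition smooth_on N (U : vec N -> Prop) (h : vec N -> R) : Prop :=
  forall (as_ : seq 'I_N) (x : vec N), U x ->
    cont_at (ipd h as_) x /\
    (forall a, ex_derive (fun t => ipd h as_ (upd x a t)) (x a)).

Definition smooth_map_on N (U : vec N -> Prop) (phi : vec N -> vec N) : Prop :=
  forall c, smooth_on U (fun z => phi z c).

Section Metric.
Variable N : nat.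
Variable g : vec N -> 'I_N -> 'I_N -> R.

Definition gmat (x : vec N) : 'M[R]_N := \matrix_(i < N, j < N) g x i j.

Definition ginv (x : vec N) (c d : 'I_N) : R := invmx (gmat x) c d.

Definition gform (x : vec N) (v w : vec N) : R :=
  rsum (fun a => rsum (fun b => v a * w b * g x a b)).

(* Christoffel symbols of the Levi-Civita connection:
   nabla_{d_a} d_b = sum_c Gam x a b c d_c *)
Definition Gam (x : vec N) (a b c : 'I_N) : R :=
  / 2 * rsum (fun d => ginv x c d *
        (pd (fun z => g z b d) a x + pd (fun z => g z a d) b x
         - pd (fun z => g z a b) d x)).

(* (1,3) curvature: R(d_a,d_b)d_c = sum_f Rup x a b c f d_f,
   with R(X,Y)Z = nabla_X nabla_Y Z - nabla_Y nabla_X Z - nabla_[X,Y] Z *)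
Definition Rup (x : vec N) (a b c f : 'I_N) : R :=
  pd (fun z => Gam z b c f) a x - pd (fun z => Gam z a c f) b x
  + rsum (fun e => Gam x b c e * Gam x a e f - Gam x a c e * Gam x b e f).

Definition Rlow (x : vec N) (a b c d : 'I_N) : R :=
  rsum (fun f => Rup x a b c f * g x f d).

(* covariant tensors (components on coordinate vector fields, indexed by
   the list of slots) *)
Definition tensor := vec N -> seq 'I_N -> R.

Definition Rten : tensor := fun x xs =>
  match xs with [:: a; b; c; d] => Rlow x a b c d | _ => 0 end.

(* (nabla T)(X_1..X_m; Y) := (nabla_Y T)(X_1..X_m): the new (direction)
   slot is the LAST one *)
Definition covD (T : tensor) : tensor := fun x xs =>
  match rev xs with
  | [::] => 0
  | y :: rys =>
      let ys := rev rys in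
      pd (fun z => T z ys) y x
      - \big[Rplus/0]_(i < size ys)
          rsum (fun e => Gam x y (nth y ys i) e * T x (set_nth y ys i e))
  end.

Definition nablaR (l : nat) : tensor := iter l covD Rten.

End Metric.

(* evaluation of a multilinear form, given by its components T (on lists of
   coordinate vectors), on a list of arbitrary vectors *)
Fixpoint evalT N (T : seq 'I_N -> R) (vs : seq (vec N)) : R :=
  match vs with
  | [::] => T [::]
  | v :: vs' => rsum (fun e => v e * evalT (fun es => T (e :: es)) vs')
  end.

(* the linear map T_P -> T_Q with matrix M: d_a |-> sum_b M a b d_b *)
Definition linmap N (M : 'M[R]_N) (v : vec N) : vec N :=
  fun b => rsum (fun a => v a * M a b).

Definition model_iso N (g1 g2 : vec N -> 'I_N -> 'I_N -> R) (l : nat)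
  (P Q : vec N) (M : 'M[R]_N) : Prop :=
  M \in unitmx /\
  (forall v w, gform g2 Q (linmap M v) (linmap M w) = gform g1 P v w) /\
  (forall i, (i <= l)%N -> forall vs : seq (vec N), size vs = (4 + i)%N ->
     evalT (nablaR g2 i Q) (map (linmap M) vs) = evalT (nablaR g1 i P) vs).

Definition curv_hom N (g : vec N -> 'I_N -> 'I_N -> R) (l : nat) : Prop :=
  forall P Q : vec N, exists M : 'M[R]_N, model_iso g g l P Q M.

Definition loc_hom N (g : vec N -> 'I_N -> 'I_N -> R) : Prop :=
  forall P Q : vec N,
  exists (U V : vec N -> Prop) (phi psi : vec N -> vec N),
    open_set U /\ open_set V /\ U P /\ phi P = Q /\
    (forall x, U x -> V (phi x) /\ psi (phi x) = x) /\
    (forall y, V y -> U (psi y) /\ phi (psi y) = y) /\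
    smooth_map_on U phi /\ smooth_map_on V psi /\
    (forall x, U x -> forall a b : 'I_N,
       rsum (fun c => rsum (fun d =>
         pd (fun z => phi z c) a x * pd (fun z => phi z d) b x * g (phi x) c d))
       = g x a b).

Unset Implicit Arguments.

Definition dimF (k : nat) : nat := (3 * k + 1).+1.

(* coordinates: index m in 0..k is u_m, index k+1+m (0<=m<=k) is v_m,
   index 2k+1+m (1<=m<=k) is s_m.  The functions f_j are F j (1<=j<=k),
   the signs eps_i are eps i (1<=i<=k). *)
Definition gF (k : nat) (eps : nat -> R) (F : nat -> R -> R)
  (x : vec (dimF k)) (a b : 'I_(dimF k)) : R :=
  let i := nat_of_ord a in
  let j := nat_of_ord b in
  let u (m : nat) := x (inord m) in
  let s (m : nat) := x (inord (2 * k + 1 + m)) in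
  if (i == 0)%N && (1 <= j <= k)%N then 2 * F j (u j) * s j
  else if (j == 0)%N && (1 <= i <= k)%N then 2 * F i (u i) * s i
  else if (i == j) && (1 <= i <= k)%N then - 2 * u 0%N * s i
  else if (i <= k)%N && (j == i + k + 1)%N then 1
  else if (j <= k)%N && (i == j + k + 1)%N then 1
  else if (i == j) && (2 * k + 2 <= i)%N then eps (i - (2 * k + 1))%N
  else 0.

Definition admissible (k : nat) (F : nat -> R -> R) : Prop :=
  forall j, (1 <= j <= k)%N ->
    (forall (n : nat) (t : R), ex_derive_n (F j) n t) /\
    (forall t, Derive_n (F j) 1 t + 1 <> 0) /\
    (forall t, Derive_n (F j) 2 t <> 0).

Definition signs (k : nat) (eps : nat -> R) : Prop :=
  forall i, (1 <= i <= k)%N -> eps i = 1 \/ eps i = -1.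

Definition beta (k : nat) (F : nat -> R -> R) (l : nat) (x : vec (dimF k)) : R :=
  \big[Rplus/0]_(1 <= j < k.+1)
     (Derive_n (F j) l.+1 (x (inord j)) *
      (1 + Derive_n (F j) 1 (x (inord j))) ^ (l - 1)
      / (Derive_n (F j) 2 (x (inord j))) ^ l).

(* Main.v *)
(** Write omega_i = du_0 /\ du_i and eta_i = du_i /\ ds_i.  The forms du_a are parallel and nabla ds_i only involves the du_a, so
      nabla^l R = sum_i [a_(l,i) (omega_i eta_i + eta_i omega_i) + b_(l,i) omega_i omega_i] du_i^l
    with a_(0,i) = 1 + f_i', a_(l,i) = f_i^(l+1) for l >= 1, and b_(l,i) some function of u_i.
    An isomorphism of models maps span(d_v), the kernel of R, to itself, hence also its orthogonal span(d_v, d_s).  Inserting the image of d_(s_j) in the fourth slot kills the b-terms, and a rank comparison shows that this image has exactly one nonzero s-component; so the indices are permuted, and a_(p,j) is replaced by c_j lambda_j^p a_(p,i), a rescaling under which beta_l does not change.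
    For local isometries phi, the Koszul formula expresses the second derivatives of phi by its first ones.  The symmetry of third derivatives then makes the u-components of phi affine functions of u, makes d_(s_j) phi^(s_i) locally constant, and gives c (1 + f_j'(u_j)) = c' (1 + f_i'(phi^(u_i))) on an open set.  Differentiating this p times along u_j yields the same rescaling relations as for models, without any appeal to the naturality of nabla^p R. *)
Require Import Defs.
From Stdlib Require Import Reals Lra FunctionalExtensionality.
From Coquelicot Require Import Coquelicot.
From mathcomp Require Import all_boot all_algebra.
From mathcomp Require Import Rstruct zify.

Set Implicit Arguments.
Unset Strict Implicit.
Unset Printing Implicit Defensive.

Local Open Scope R_scope.

(** * Finite real sums and rules of differentiation *)

Lemma rsum_ext (n : nat) (f g : 'I_n -> R) : f =1 g -> rsum f = rsum g.
Proof. by move=> fg; apply: eq_bigr => i _; apply: fg. Qed.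

Lemma rsum_add (n : nat) (f g : 'I_n -> R) :
  rsum (fun i => f i + g i) = rsum f + rsum g.
Proof. exact: big_split. Qed.

Lemma rsum_mull (n : nat) (c : R) (f : 'I_n -> R) :
  rsum (fun i => c * f i) = c * rsum f.
Proof. by rewrite /rsum -big_distrr. Qed.

Lemma rsum_mulr (n : nat) (c : R) (f : 'I_n -> R) :
  rsum (fun i => f i * c) = rsum f * c.
Proof. by rewrite /rsum -big_distrl. Qed.

Lemma rsum_sub (n : nat) (f g : 'I_n -> R) :
  rsum (fun i => f i - g i) = rsum f - rsum g.
Proof.
rewrite (_ : rsum f - rsum g = rsum f + -1 * rsum g); last by ring.
by rewrite -rsum_mull -rsum_add; apply: rsum_ext => i; ring.
Qed.

Lemma rsum_swap (m n : nat) (f : 'I_m -> 'I_n -> R) :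
  rsum (fun i => rsum (f i)) = rsum (fun j => rsum (fun i => f i j)).
Proof. exact: exchange_big. Qed.

Lemma rsum_zero (n : nat) (f : 'I_n -> R) : (forall i, f i = 0) -> rsum f = 0.
Proof. by move=> f0; rewrite /rsum big1. Qed.

Lemma rsum_pick (n : nat) (j : 'I_n) (f : 'I_n -> R) :
  (forall i, i != j -> f i = 0) -> rsum f = f j.
Proof. by move=> f0; rewrite /rsum (bigD1 j) //= big1 //; exact: Rplus_0_r. Qed.

Arguments rsum_pick {n} j {f} _.

Lemma is_derive_rsum (n : nat) (f : 'I_n -> R -> R) (df : 'I_n -> R) (x : R) :
  (forall i, is_derive (f i) x (df i)) ->
  is_derive (fun t => rsum (fun i => f i t)) x (rsum df).
Proof.
move=> H; rewrite /rsum.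
elim: (index_enum _) => [|i s IH].
  rewrite big_nil; apply: (is_derive_ext (fun=> 0)).
    by move=> t; rewrite big_nil.
  exact: is_derive_const.
rewrite big_cons.
apply: (is_derive_ext (fun t => f i t + \big[Rplus/0]_(j <- s) f j t)).
  by move=> t; rewrite big_cons.
exact: is_derive_plus (H i) IH.
Qed.

Lemma is_derive_mulR (f g : R -> R) (x df dg : R) :
  is_derive f x df -> is_derive g x dg ->
  is_derive (fun t => f t * g t) x (df * g x + f x * dg).
Proof. by move=> Hf Hg; apply: (is_derive_mult f g) => // n m; apply: Rmult_comm. Qed.

Lemma is_derive_addR (f g : R -> R) (x df dg : R) :
  is_derive f x df -> is_derive g x dg ->
  is_derive (fun t => f t + g t) x (df + dg).
Proof. exact: is_derive_plus. Qed.

Lemma is_derive_subR (f g : R -> R) (x df dg : R) :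
  is_derive f x df -> is_derive g x dg ->
  is_derive (fun t => f t - g t) x (df - dg).
Proof. exact: is_derive_minus. Qed.

Lemma is_derive_cstR (c x : R) : is_derive (fun _ : R => c) x 0.
Proof. exact: is_derive_const. Qed.

Lemma is_derive_eqR (f : R -> R) (x d d' : R) :
  is_derive f x d -> d = d' -> is_derive f x d'.
Proof. by move=> H <-. Qed.

Lemma is_derive_compR (f g : R -> R) (x df dg : R) :
  is_derive f (g x) df -> is_derive g x dg -> is_derive (fun t => f (g t)) x (df * dg).
Proof.
move=> Hf Hg; apply: is_derive_eqR (is_derive_comp _ _ _ _ _ Hf Hg) _.
exact: Rmult_comm.
Qed.

(** * Linear functionals on tangent vectors *)

Definition basis (N : nat) (a : 'I_N) : vec N := fun c => if c == a then 1 else 0.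
Arguments basis {N} a _ : simpl never.

Lemma basis_sum (N : nat) (v : vec N) (c : 'I_N) :
  v c = rsum (fun a => v a * basis a c).
Proof.
rewrite (rsum_pick c) /basis; first by rewrite eqxx; ring.
by move=> i ic; rewrite eq_sym (negbTE ic); ring.
Qed.

(** Linearity is encoded as expansion in the coordinate basis, so that rewriting with it turns a
    value directly into the sum over components in which the tensors of the statement are
    expressed. *)
Definition lin (N : nat) (L : vec N -> R) : Prop :=
  forall v, L v = rsum (fun a => v a * L (basis a)).

Lemma lin_coord (N : nat) (c : 'I_N) : lin (fun v => v c).
Proof. by move=> v; apply: basis_sum. Qed.

Lemma lin_add (N : nat) (L1 L2 : vec N -> R) :
  lin L1 -> lin L2 -> lin (fun v => L1 v + L2 v).
Proof.
move=> H1 H2 v; rewrite H1 H2 -rsum_add.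
by apply: rsum_ext => a; ring.
Qed.

Lemma lin_mull (N : nat) (c : R) (L : vec N -> R) :
  lin L -> lin (fun v => c * L v).
Proof.
move=> H v; rewrite H -rsum_mull.
by apply: rsum_ext => a; ring.
Qed.

Lemma lin_ext (N : nat) (L1 L2 : vec N -> R) : L1 =1 L2 -> lin L1 -> lin L2.
Proof. by move=> E H v; rewrite -!E H; apply: rsum_ext => a; rewrite E. Qed.

Lemma lin_mulr (N : nat) (c : R) (L : vec N -> R) :
  lin L -> lin (fun v => L v * c).
Proof. by move=> H; apply: lin_ext (lin_mull c H) => v; ring. Qed.

Lemma lin_opp (N : nat) (L : vec N -> R) : lin L -> lin (fun v => - L v).
Proof. by move=> H; apply: lin_ext (lin_mull (-1) H) => v; ring. Qed.

Lemma lin_sub (N : nat) (L1 L2 : vec N -> R) :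
  lin L1 -> lin L2 -> lin (fun v => L1 v - L2 v).
Proof.
by move=> H1 H2; apply: lin_add => //; apply: lin_opp.
Qed.

Lemma lin_rsum (N n : nat) (L : 'I_n -> vec N -> R) :
  (forall i, lin (L i)) -> lin (fun v => rsum (fun i => L i v)).
Proof.
move=> H v.
transitivity (rsum (fun i => rsum (fun a => v a * L i (basis a)))).
  by apply: rsum_ext => i; apply: H.
by rewrite rsum_swap; apply: rsum_ext => a; rewrite -rsum_mull.
Qed.

Ltac lin_tac := repeat match goal with
  | |- lin (fun v => v _) => apply: lin_coord
  | |- lin (fun v => rsum _) => apply: lin_rsum => ?
  | |- lin (fun v => _ + _) => apply: lin_add
  | |- lin (fun v => _ - _) => apply: lin_sub
  | |- lin (fun v => ?c * @?L v) =>
      first [apply: (lin_mull c) | apply: lin_mulr]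
  end.

Lemma lin0 (N : nat) (L : vec N -> R) : lin L -> L (fun=> 0) = 0.
Proof. by move=> H; rewrite H; apply: rsum_zero => a; ring. Qed.

Lemma upd_id (N : nat) (x : vec N) (a : 'I_N) : upd x a (x a) = x.
Proof.
by apply: functional_extensionality => i; rewrite /upd; case: eqP => [->|].
Qed.

Lemma is_derive_upd (N : nat) (x : vec N) (a : 'I_N) t (c : 'I_N) :
  is_derive (fun t => upd x a t c) t (basis a c).
Proof.
by rewrite /upd /basis; case: eqP => _; [apply: is_derive_id | apply: is_derive_cstR].
Qed.

Lemma pd_derive (N : nat) (h : vec N -> R) (a : 'I_N) (x : vec N) (d : R) :
  is_derive (fun t => h (upd x a t)) (x a) d -> pd h a x = d.
Proof. exact: is_derive_unique. Qed.

Ltac derive_tac := repeat match goal with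
  | H : _ |- _ => apply: H
  | |- is_derive (fun _ => ?c) _ _ => apply: is_derive_cstR
  | |- is_derive (fun t => rsum _) _ _ => apply: is_derive_rsum => ?
  | |- is_derive (fun t => _ + _) _ _ => apply: is_derive_addR
  | |- is_derive (fun t => _ - _) _ _ => apply: is_derive_subR
  | |- is_derive (fun t => _ * _) _ _ => apply: is_derive_mulR
  | |- is_derive (fun t => ?f (@?g t)) _ _ => apply: is_derive_compR
  end.

(** * Coordinates *)

Section Coordinates.
Variable k : nat.
Local Notation I := 'I_(dimF k).
Local Notation V := (vec (dimF k)).

(* [cu i], [cv i], [cs i] are the positions of u_(i+1), v_(i+1), s_(i+1); the same shift applies to [df p i] and [sign i] below. *)
Definition cu0 : I := inord 0.
Definition cu (i : nat) : I := inord i.+1.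
Definition cv0 : I := inord (k + 1).
Definition cv (i : nat) : I := inord (k + 1 + i.+1).
Definition cs (i : nat) : I := inord (2 * k + 1 + i.+1).

Lemma cu0_val : cu0 = 0%N :> nat.
Proof. by rewrite inordK. Qed.
Lemma cv0_val : cv0 = (k + 1)%N :> nat.
Proof. by rewrite inordK // /dimF; lia. Qed.
Lemma cu_val (i : 'I_k) : cu i = i.+1 :> nat.
Proof. by have := ltn_ord i => ?; rewrite inordK // /dimF; lia. Qed.
Lemma cv_val (i : 'I_k) : cv i = (k + 1 + i.+1)%N :> nat.
Proof. by have := ltn_ord i => ?; rewrite inordK // /dimF; lia. Qed.
Lemma cs_val (i : 'I_k) : cs i = (2 * k + 1 + i.+1)%N :> nat.
Proof. by have := ltn_ord i => ?; rewrite inordK // /dimF; lia. Qed.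

Variant index_spec : I -> Type :=
  | IndexU0 : index_spec cu0
  | IndexU (i : 'I_k) : index_spec (cu i)
  | IndexV0 : index_spec cv0
  | IndexV (i : 'I_k) : index_spec (cv i)
  | IndexS (i : 'I_k) : index_spec (cs i).

Lemma indexP (a : I) : index_spec a.
Proof.
have Ha : (a < 3 * k + 2)%N by apply: leq_trans (ltn_ord a) _; rewrite /dimF; lia.
case: (posnP a) => [a0|a0].
  by rewrite (_ : a = cu0); [constructor | apply: ord_inj; rewrite cu0_val].
case: (leqP a k) => ak.
  have lt : (a.-1 < k)%N by lia.
  rewrite (_ : a = cu (Ordinal lt)); first by constructor.
  by apply: ord_inj; rewrite cu_val /=; lia.
case: (eqVneq (a : nat) (k + 1)%N) => [a1|a1].
  by rewrite (_ : a = cv0); [constructor | apply: ord_inj; rewrite cv0_val].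
case: (leqP a (2 * k + 1)) => a2.
  have lt : (a - (k + 2) < k)%N by lia.
  rewrite (_ : a = cv (Ordinal lt)); first by constructor.
  by apply: ord_inj; rewrite cv_val /=; lia.
have lt : (a - (2 * k + 2) < k)%N by lia.
rewrite (_ : a = cs (Ordinal lt)); first by constructor.
by apply: ord_inj; rewrite cs_val /=; lia.
Qed.

Definition vals := (cu0_val, cv0_val, cu_val, cv_val, cs_val).

Lemma basisE (a c : I) : basis a c = if (c == a :> nat) then 1 else 0.
Proof. by []. Qed.

Lemma basis_u_u (i j : 'I_k) : basis (cu i) (cu j) = if j == i then 1 else 0.
Proof. by rewrite basisE !vals eqSS. Qed.
Lemma basis_v_v (i j : 'I_k) : basis (cv i) (cv j) = if j == i then 1 else 0.
Proof. by rewrite basisE !vals eqn_add2l eqSS. Qed.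
Lemma basis_s_s (i j : 'I_k) : basis (cs i) (cs j) = if j == i then 1 else 0.
Proof. by rewrite basisE !vals eqn_add2l eqSS. Qed.
Lemma basis_u0_u0 : basis cu0 cu0 = 1. Proof. by rewrite basisE eqxx. Qed.
Lemma basis_v0_v0 : basis cv0 cv0 = 1. Proof. by rewrite basisE eqxx. Qed.

Ltac off := rewrite basisE !vals; case: eqP => [e|//]; exfalso; lia.
Lemma basis_u0_u i : basis cu0 (cu (i : 'I_k)) = 0. Proof. off. Qed.
Lemma basis_u0_v0 : basis cu0 cv0 = 0. Proof. off. Qed.
Lemma basis_u0_v i : basis cu0 (cv (i : 'I_k)) = 0. Proof. off. Qed.
Lemma basis_u0_s i : basis cu0 (cs (i : 'I_k)) = 0. Proof. off. Qed.
Lemma basis_u_u0 i : basis (cu (i : 'I_k)) cu0 = 0. Proof. off. Qed.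
Lemma basis_u_v0 i : basis (cu (i : 'I_k)) cv0 = 0. Proof. have ? := ltn_ord i; off. Qed.
Lemma basis_u_v i j : basis (cu (i : 'I_k)) (cv (j : 'I_k)) = 0. Proof. have ? := ltn_ord i; off. Qed.
Lemma basis_u_s i j : basis (cu (i : 'I_k)) (cs (j : 'I_k)) = 0. Proof. have ? := ltn_ord i; off. Qed.
Lemma basis_v0_u0 : basis cv0 cu0 = 0. Proof. off. Qed.
Lemma basis_v0_u i : basis cv0 (cu (i : 'I_k)) = 0. Proof. have ? := ltn_ord i; off. Qed.
Lemma basis_v0_v i : basis cv0 (cv (i : 'I_k)) = 0. Proof. off. Qed.
Lemma basis_v0_s i : basis cv0 (cs (i : 'I_k)) = 0. Proof. off. Qed.
Lemma basis_v_u0 i : basis (cv (i : 'I_k)) cu0 = 0. Proof. off. Qed.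
Lemma basis_v_u i j : basis (cv (i : 'I_k)) (cu (j : 'I_k)) = 0. Proof. have ? := ltn_ord j; off. Qed.
Lemma basis_v_v0 i : basis (cv (i : 'I_k)) cv0 = 0. Proof. off. Qed.
Lemma basis_v_s i j : basis (cv (i : 'I_k)) (cs (j : 'I_k)) = 0. Proof. have ? := ltn_ord i; off. Qed.
Lemma basis_s_u0 i : basis (cs (i : 'I_k)) cu0 = 0. Proof. off. Qed.
Lemma basis_s_u i j : basis (cs (i : 'I_k)) (cu (j : 'I_k)) = 0. Proof. have ? := ltn_ord j; off. Qed.
Lemma basis_s_v0 i : basis (cs (i : 'I_k)) cv0 = 0. Proof. off. Qed.
Lemma basis_s_v i j : basis (cs (i : 'I_k)) (cv (j : 'I_k)) = 0. Proof. have ? := ltn_ord j; off. Qed.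

Definition basis_val := (basis_u0_u0, basis_u0_u, basis_u0_v0, basis_u0_v, basis_u0_s, basis_u_u0, basis_u_u, basis_u_v0, basis_u_v, basis_u_s,
  basis_v0_u0, basis_v0_u, basis_v0_v0, basis_v0_v, basis_v0_s, basis_v_u0, basis_v_u, basis_v_v0, basis_v_v, basis_v_s, basis_s_u0, basis_s_u, basis_s_v0, basis_s_v, basis_s_s).

(** The index range is cut at 1, k+1, k+2 and 2k+2 into the blocks of u_0, the u_i, v_0, the v_i and
    the s_i. *)
Lemma rsum_index (h : I -> R) :
  rsum h = h cu0 + h cv0 + rsum (fun i : 'I_k => h (cu i) + h (cv i) + h (cs i)).
Proof.
rewrite /rsum.
rewrite (eq_bigr (fun i : I => h (inord i))); last by move=> i _; rewrite inord_val.
rewrite -(big_mkord xpredT (fun m => h (inord m))).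
rewrite (big_cat_nat (n := 1)) //; try by rewrite /dimF; lia.
rewrite big_nat1.
rewrite (big_cat_nat (n := (k + 1)%N)) //=; try by rewrite /dimF; lia.
rewrite (big_cat_nat (n := (k + 2)%N) (m := (k + 1)%N)) //=; try by rewrite /dimF; lia.
rewrite (_ : (k + 2)%N = (k + 1).+1); last by lia.
rewrite big_nat1.
rewrite (big_cat_nat (n := (2 * k + 2)%N) (m := (k + 1).+1)) //=; try by rewrite /dimF; lia.
have T (a b : nat) (g : nat -> R) : (b = a + k)%N ->
   \big[Rplus/0]_(a <= m < b) g m = rsum (fun i : 'I_k => g (a + i)%N).
  move=> ->; rewrite -{1}(add0n a) (addnC a k) big_addn (_ : (k + a - a)%N = k); last by lia.
  by rewrite big_mkord; apply: eq_bigr => i _; rewrite addnC.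
rewrite (T 1%N (k + 1)%N) ?(T (k + 1).+1 (2 * k + 2)%N) ?(T (2 * k + 2)%N); try by rewrite /dimF; lia.
have -> : rsum (fun i : 'I_k => h (inord (1 + i))) = rsum (fun i : 'I_k => h (cu i)) by [].
have -> : rsum (fun i : 'I_k => h (inord ((k + 1).+1 + i))) = rsum (fun i : 'I_k => h (cv i)).
  by apply: rsum_ext => i; rewrite /cv; congr (h (inord _)); lia.
have -> : rsum (fun i : 'I_k => h (inord (2 * k + 2 + i))) = rsum (fun i : 'I_k => h (cs i)).
  by apply: rsum_ext => i; rewrite /cs; congr (h (inord _)); lia.
rewrite -/(rsum _) !rsum_add /cu0 /cv0 /=.
change (h (inord 0) + (rsum (fun i : 'I_k => h (cu i)) + (h (inord (k + 1)) + (rsum (fun i : 'I_k => h (cv i)) + rsum (fun i : 'I_k => h (cs i)))))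
 = h (inord 0) + h (inord (k + 1)) + (rsum (fun i : 'I_k => h (cu i)) + rsum (fun i : 'I_k => h (cv i)) + rsum (fun i : 'I_k => h (cs i)))).
ring.
Qed.

End Coordinates.

(** * Curvature of gF *)

Section Metric.
Variables (k : nat) (eps : nat -> R) (F : nat -> R -> R).
Hypothesis eps_signs : signs k eps.
Hypothesis F_smooth : forall (i : 'I_k) n t, ex_derive_n (F i.+1) n t.
Local Notation I := 'I_(dimF k).
Local Notation V := (vec (dimF k)).
Local Notation cu0 := (cu0 k).
Local Notation cu := (cu k).
Local Notation cv0 := (cv0 k).
Local Notation cv := (cv k).
Local Notation cs := (cs k).

Definition df (p i : nat) (t : R) : R := Derive_n (F i.+1) p t.
Definition sign (i : nat) : R := eps i.+1.

Lemma is_derive_df p (i : 'I_k) t : is_derive (df p i) t (df p.+1 i t).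
Proof. exact: Derive_correct (F_smooth i p.+1 t). Qed.

Lemma sign_sq (i : 'I_k) : sign i * sign i = 1.
Proof.
have [] : eps i.+1 = 1 \/ eps i.+1 = -1 by apply: eps_signs; rewrite /= ltn_ord.
  by rewrite /sign => ->; ring.
by rewrite /sign => ->; ring.
Qed.

Lemma sign_neq0 (i : 'I_k) : sign i <> 0.
Proof. by move=> s0; have := sign_sq i; rewrite s0; lra. Qed.

(* The metric, its Christoffel symbols and its curvature are written as functions of arbitrary vectors [v w], whose components play the role of the forms du, dv, ds; the coordinate components are then the values at [basis] vectors. *)
Definition gform_F_term (x v w : V) (i : nat) : R :=
  2 * df 0 i (x (cu i)) * x (cs i) * (v cu0 * w (cu i) + v (cu i) * w cu0)
  - 2 * x cu0 * x (cs i) * (v (cu i) * w (cu i))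
  + (v (cu i) * w (cv i) + v (cv i) * w (cu i)) + sign i * (v (cs i) * w (cs i)).

Definition gform_F (x v w : V) : R :=
  v cu0 * w cv0 + v cv0 * w cu0 + rsum (fun i : 'I_k => gform_F_term x v w i).

Lemma gform_F_sym x v w : gform_F x v w = gform_F x w v.
Proof.
rewrite /gform_F; congr (_ + _); first by ring.
by apply: rsum_ext => i; rewrite /gform_F_term; ring.
Qed.

Lemma lin_gform_Fr x v : lin (gform_F x v).
Proof. by rewrite /gform_F /gform_F_term; lin_tac. Qed.

Lemma lin_gform_Fl x w : lin (fun v => gform_F x v w).
Proof. by apply: lin_ext (lin_gform_Fr x w) => v; apply: gform_F_sym. Qed.

Lemma gform_F_cu0 x v :
  gform_F x v (basis cu0) =
  v cv0 + rsum (fun i : 'I_k => 2 * df 0 i (x (cu i)) * x (cs i) * v (cu i)).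
Proof.
rewrite /gform_F /gform_F_term !basis_val Rmult_0_r Rplus_0_l Rmult_1_r; congr (_ + _).
by apply: rsum_ext => i; rewrite !basis_val; ring.
Qed.

Lemma gform_F_cu x v (j : 'I_k) :
  gform_F x v (basis (cu j)) =
  2 * df 0 j (x (cu j)) * x (cs j) * v cu0 - 2 * x cu0 * x (cs j) * v (cu j) + v (cv j).
Proof.
rewrite /gform_F /gform_F_term !basis_val (rsum_pick j) => [|i ij]; rewrite !basis_val.
  by rewrite eqxx; ring.
by rewrite (negbTE ij); ring.
Qed.

Lemma gform_F_cv0 x v : gform_F x v (basis cv0) = v cu0.
Proof.
by rewrite /gform_F /gform_F_term !basis_val rsum_zero => [|i]; rewrite ?basis_val; ring.
Qed.

Lemma gform_F_cv x v (j : 'I_k) : gform_F x v (basis (cv j)) = v (cu j).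
Proof.
rewrite /gform_F /gform_F_term !basis_val (rsum_pick j) => [|i ij]; rewrite !basis_val.
  by rewrite eqxx; ring.
by rewrite (negbTE ij); ring.
Qed.

Lemma gform_F_cs x v (j : 'I_k) : gform_F x v (basis (cs j)) = sign j * v (cs j).
Proof.
rewrite /gform_F /gform_F_term !basis_val (rsum_pick j) => [|i ij]; rewrite !basis_val.
  by rewrite eqxx; ring.
by rewrite (negbTE ij); ring.
Qed.

Lemma gFE (x : V) (a b : I) : gF k eps F x a b = gform_F x (basis a) (basis b).
Proof.
case: (indexP b) => [|j||j|j]; case: (indexP a) => [|i||i|i];
  rewrite ?gform_F_cu0 ?gform_F_cu ?gform_F_cv0 ?gform_F_cv ?gform_F_cs /gF !vals; cbv zeta;
  try have ? := ltn_ord i; try have ? := ltn_ord j;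
  try (case: (eqVneq i j) => [Eij|/eqP Nij];
       [subst j
       | (have Nij' : i <> j :> nat by move=> /ord_inj)
       ; (have Nji : (j == i) = false by apply/negbTE/eqP => E; apply: Nij; rewrite E)]);
  repeat (case: ifP => ?; try (exfalso; lia));
  rewrite !basis_val ?eqxx ?Nji; try ring;
  try (rewrite rsum_zero; [ring | move=> i'; rewrite basis_val; ring]).
(* Four goals survive the computation, for the index pairs (u_i, u_0), (u_0, u_j), (u_i, u_i) and
   (s_i, s_i): the entries that involve a coordinate or a sign. *)
- rewrite (rsum_pick i) => [|i' ne]; rewrite basis_val.
    by rewrite eqxx /df /= -/(cu i) -/(cs i); ring.
  by rewrite (negbTE ne); ring.
- by rewrite /df /= -/(cu j) -/(cs j); ring.
- by rewrite -/cu0 -/(cs i); ring.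
- by rewrite /sign addKn; ring.
Qed.

Lemma gformE x v w : gform (gF k eps F) x v w = gform_F x v w.
Proof.
rewrite /gform [RHS](lin_gform_Fl x w); apply: rsum_ext => a.
rewrite [in RHS](lin_gform_Fr x (basis a)) -rsum_mull; apply: rsum_ext => b.
by rewrite gFE; ring.
Qed.

Definition dgform_F_term (x z v w : V) (i : nat) : R :=
  2 * (df 1 i (x (cu i)) * z (cu i) * x (cs i) + df 0 i (x (cu i)) * z (cs i))
    * (v cu0 * w (cu i) + v (cu i) * w cu0)
  - 2 * (z cu0 * x (cs i) + x cu0 * z (cs i)) * (v (cu i) * w (cu i)).

Definition dgform_F (x z v w : V) : R := rsum (fun i : 'I_k => dgform_F_term x z v w i).

(** Leibniz rule along a curve of base points. With constant basis vectors it yields the partial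
    derivatives of the metric; with the images of coordinate fields under a map it differentiates
    the isometry equation. *)
Lemma is_derive_gform_F (g v w : R -> V) (t : R) (g' v' w' : V) :
  (forall c, is_derive (fun s => g s c) t (g' c)) ->
  (forall c, is_derive (fun s => v s c) t (v' c)) ->
  (forall c, is_derive (fun s => w s c) t (w' c)) ->
  is_derive (fun s => gform_F (g s) (v s) (w s)) t
    (dgform_F (g t) g' (v t) (w t) + gform_F (g t) v' (w t) + gform_F (g t) (v t) w').
Proof.
move=> Hg Hv Hw; rewrite /gform_F /gform_F_term; apply: is_derive_eqR.
  by repeat (derive_tac; try apply: is_derive_df).
rewrite /= (rsum_ext (g := fun i : 'I_k =>
    dgform_F_term (g t) g' (v t) (w t) i + gform_F_term (g t) v' (w t) i + gform_F_term (g t) (v t) w' i)).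
  by rewrite 2!rsum_add /dgform_F /gform_F_term; ring.
by move=> i; rewrite /dgform_F_term /gform_F_term; ring.
Qed.

(* The Christoffel vector fields and R(X,Y)Z have no u-components. *)
Definition vs_vec (y0 : R) (y s : nat -> R) : V := fun c =>
  if c == cv0 then y0
  else if (k + 1 < c <= 2 * k + 1)%N then y (c - (k + 2))%N
  else if (2 * k + 1 < c)%N then s (c - (2 * k + 2))%N
  else 0.

Ltac vs_vec_tac := rewrite /vs_vec -val_eqE /= !vals;
  repeat (case: ifP => ?; try (exfalso; lia)).

Lemma vs_vec_cu0 y0 y s : vs_vec y0 y s cu0 = 0.
Proof. by vs_vec_tac. Qed.
Lemma vs_vec_cu y0 y s (i : 'I_k) : vs_vec y0 y s (cu i) = 0.
Proof. have ? := ltn_ord i; by vs_vec_tac. Qed.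
Lemma vs_vec_cv0 y0 y s : vs_vec y0 y s cv0 = y0.
Proof. by rewrite /vs_vec eqxx. Qed.
Lemma vs_vec_cv y0 y s (i : 'I_k) : vs_vec y0 y s (cv i) = y i.
Proof. have ? := ltn_ord i; vs_vec_tac; congr y; lia. Qed.
Lemma vs_vec_cs y0 y s (i : 'I_k) : vs_vec y0 y s (cs i) = s i.
Proof. have ? := ltn_ord i; vs_vec_tac; congr s; lia. Qed.
Definition vs_vecE := (vs_vec_cu0, vs_vec_cu, vs_vec_cv0, vs_vec_cv, vs_vec_cs).

Lemma gform_F_vs_vec x y0 y s w :
  gform_F x (vs_vec y0 y s) w =
  y0 * w cu0 + rsum (fun i : 'I_k => y i * w (cu i) + sign i * (s i * w (cs i))).
Proof.
rewrite /gform_F /gform_F_term !vs_vecE; congr (_ + _); first by ring.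
by apply: rsum_ext => i; rewrite !vs_vecE; ring.
Qed.

Definition chris_s (x v w : V) (i : nat) : R :=
  sign i * (x cu0 * (v (cu i) * w (cu i))
          - df 0 i (x (cu i)) * (v cu0 * w (cu i) + v (cu i) * w cu0)).

Definition chris_v (x v w : V) (i : nat) : R :=
  df 0 i (x (cu i)) * (v cu0 * w (cs i) + v (cs i) * w cu0)
  - x (cs i) * (v cu0 * w (cu i) + v (cu i) * w cu0)
  - x cu0 * (v (cu i) * w (cs i) + v (cs i) * w (cu i)).

Definition chris_v0 (x v w : V) (i : nat) : R :=
  (2 * df 1 i (x (cu i)) + 1) * x (cs i) * (v (cu i) * w (cu i))
  + df 0 i (x (cu i)) * (v (cu i) * w (cs i) + v (cs i) * w (cu i)).

Definition chris (x v w : V) : V :=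
  vs_vec (rsum (fun i : 'I_k => chris_v0 x v w i)) (chris_v x v w) (chris_s x v w).

(* The Koszul formula: [dgform_F x z v w] is the derivative of [gform_F] in the direction [z] of the base point. *)
Lemma koszul_gF x u v w :
  / 2 * (dgform_F x u v w + dgform_F x v u w - dgform_F x w u v) = gform_F x (chris x u v) w.
Proof.
rewrite gform_F_vs_vec -rsum_mulr -rsum_add /dgform_F -rsum_add -rsum_sub -rsum_mull.
apply: rsum_ext => i; rewrite /dgform_F_term /chris_v0 /chris_v /chris_s.
have s2 := sign_sq i.
(* The product [sign i * sign i] is kept visible: one factor comes from [chris_s], the other from
   the metric, and together they give 1. *)
transitivity (
  (df 1 i (x (cu i)) * 2 + 1) * x (cs i) * u (cu i) * v (cu i) * w cu0
  + df 0 i (x (cu i)) * (u (cu i) * v (cs i) + u (cs i) * v (cu i)) * w cu0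
  + chris_v x u v i * w (cu i) + (sign i * sign i) * (x cu0 * (u (cu i) * v (cu i))
          - df 0 i (x (cu i)) * (u cu0 * v (cu i) + u (cu i) * v cu0)) * w (cs i)).
  by rewrite s2 /chris_v; field.
by rewrite /chris_v; ring.
Qed.

(** Let u be orthogonal to every basis vector. Pairing with the d_v kills its u-components; then
    pairing with the d_u and d_s kills the v- and s-components. *)
Lemma gF_unit x : gmat (gF k eps F) x \in unitmx.
Proof.
rewrite -row_free_unit; apply: inj_row_free => v v0.
pose u : V := fun a => v ord0 a.
have E b : gform_F x u (basis b) = 0.
  transitivity ((v *m gmat (gF k eps F) x)%R ord0 b); last by rewrite v0 mxE.
  rewrite mxE (lin_gform_Fl x (basis b)); apply: eq_bigr => a _.
  by rewrite mxE gFE.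
have x0 : u cu0 = 0 by rewrite -(E cv0) gform_F_cv0.
have xi (i : 'I_k) : u (cu i) = 0 by rewrite -(E (cv i)) gform_F_cv.
apply/rowP => b; rewrite [RHS]mxE; change (u b = 0); case: (indexP b) => [//|i|//|i|i].
- exact: xi.
- have := E cu0; rewrite gform_F_cu0 rsum_zero; last by move=> i; rewrite xi; ring.
  by rewrite Rplus_0_r.
- by have := E (cu i); rewrite gform_F_cu x0 xi => <-; ring.
- have := E (cs i); rewrite gform_F_cs => /Rmult_integral [] //.
  by move/sign_neq0.
Qed.

(** Raising the index of a lowered vector returns the vector. This avoids inverting the metric: for
    [Gam] it suffices to exhibit a vector whose pairings are the Koszul expressions. *)
Lemma ginv_gF x (u : V) c :
  rsum (fun d => ginv (gF k eps F) x c d * gform_F x u (basis d)) = u c.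
Proof.
transitivity (((\row_a u a) *m (gmat (gF k eps F) x *m invmx (gmat (gF k eps F) x)))%R ord0 c);
  last by rewrite mulmxV ?gF_unit // mulmx1 mxE.
have sym : (gmat (gF k eps F) x)^T%R = gmat (gF k eps F) x.
  by apply/matrixP => a b; rewrite !mxE !gFE gform_F_sym.
rewrite mulmxA [RHS]mxE; apply: eq_bigr => d _.
rewrite Rmult_comm; congr (_ * _).
  rewrite mxE (lin_gform_Fl x (basis d)); apply: eq_bigr => a _.
  by rewrite !mxE gFE.
by rewrite /ginv -[in RHS]sym -trmx_inv mxE.
Qed.

Lemma pd_gF x (a b d : I) :
  pd (fun z => gF k eps F z b d) a x = dgform_F x (basis a) (basis b) (basis d).
Proof.
apply: pd_derive.
have z0 : forall c : I, is_derive (fun _ : R => basis b c) (x a) ((fun=> 0) c).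
  by move=> c; apply: is_derive_cstR.
have z1 : forall c : I, is_derive (fun _ : R => basis d c) (x a) ((fun=> 0) c).
  by move=> c; apply: is_derive_cstR.
have := is_derive_gform_F (is_derive_upd x a (x a)) z0 z1.
rewrite upd_id (lin0 (lin_gform_Fl x (basis d))) (lin0 (lin_gform_Fr x (basis b))) !Rplus_0_r.
by apply: is_derive_ext => t; rewrite gFE.
Qed.

Lemma Gam_gF x (a b c : I) : Gam (gF k eps F) x a b c = chris x (basis a) (basis b) c.
Proof.
rewrite /Gam -rsum_mull -(ginv_gF x (chris x (basis a) (basis b)) c).
apply: rsum_ext => d; rewrite !pd_gF -koszul_gF; ring.
Qed.

(** * The curvature tensor *)

Definition omega (v w : V) (i : nat) : R := v cu0 * w (cu i) - v (cu i) * w cu0.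
Definition eta (v w : V) (i : nat) : R := v (cu i) * w (cs i) - v (cs i) * w (cu i).

(** The components of R(u,v)w. In them u_0, the s_i and the f_i'' have cancelled, so the base point
    enters only through the coordinates u_i. *)
Definition curv_s (x u v w : V) (i : nat) : R :=
  sign i * (1 + df 1 i (x (cu i))) * omega u v i * w (cu i).
Definition curv_v (x u v w : V) (i : nat) : R :=
  (1 + df 1 i (x (cu i))) * (eta u v i * w cu0 - omega u v i * w (cs i))
  - sign i * df 0 i (x (cu i)) ^ 2 * omega u v i * w cu0.
Definition curv_v0 (x u v w : V) (i : nat) : R :=
  sign i * df 0 i (x (cu i)) ^ 2 * omega u v i * w (cu i)
  - (1 + df 1 i (x (cu i))) * eta u v i * w (cu i).
Definition curv (x u v w : V) : V :=
  vs_vec (rsum (fun i : 'I_k => curv_v0 x u v w i)) (curv_v x u v w) (curv_s x u v w).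

(** The vectors are allowed to move because this is later applied to the Christoffel term pulled
    back by a local isometry. *)
Lemma is_derive_chris_s (g v w : R -> V) (t : R) (g' v' w' : V) (i : 'I_k) :
  (forall c, is_derive (fun s => g s c) t (g' c)) ->
  (forall c, is_derive (fun s => v s c) t (v' c)) ->
  (forall c, is_derive (fun s => w s c) t (w' c)) ->
  is_derive (fun s => chris_s (g s) (v s) (w s) i) t
    (sign i * (g' cu0 * (v t (cu i) * w t (cu i)) - df 1 i (g t (cu i)) * g' (cu i)
       * (v t cu0 * w t (cu i) + v t (cu i) * w t cu0))
     + chris_s (g t) v' (w t) i + chris_s (g t) (v t) w' i).
Proof.
move=> Hg Hv Hw; rewrite /chris_s; apply: is_derive_eqR.
  by repeat (derive_tac; try apply: is_derive_df).
by rewrite /=; ring.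
Qed.

Lemma pd_Gam_cs x (a b c : I) (i : 'I_k) :
  pd (fun z => Gam (gF k eps F) z b c (cs i)) a x =
  sign i * (basis a cu0 * (basis b (cu i) * basis c (cu i))
     - df 1 i (x (cu i)) * basis a (cu i)
       * (basis b cu0 * basis c (cu i) + basis b (cu i) * basis c cu0)).
Proof.
apply: pd_derive.
apply: (is_derive_ext (fun t => chris_s (upd x a t) (basis b) (basis c) i)).
  by move=> t; rewrite Gam_gF /chris vs_vec_cs.
have Hg := is_derive_upd x a (x a); rewrite /chris_s; apply: is_derive_eqR.
  by repeat (derive_tac; try apply: is_derive_df).
by rewrite /= upd_id; ring.
Qed.

Lemma pd_Gam_cv x (a b c : I) (i : 'I_k) :
  pd (fun z => Gam (gF k eps F) z b c (cv i)) a x =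
  df 1 i (x (cu i)) * basis a (cu i)
    * (basis b cu0 * basis c (cs i) + basis b (cs i) * basis c cu0)
  - basis a (cs i) * (basis b cu0 * basis c (cu i) + basis b (cu i) * basis c cu0)
  - basis a cu0 * (basis b (cu i) * basis c (cs i) + basis b (cs i) * basis c (cu i)).
Proof.
apply: pd_derive.
apply: (is_derive_ext (fun t => chris_v (upd x a t) (basis b) (basis c) i)).
  by move=> t; rewrite Gam_gF /chris vs_vec_cv.
have Hg := is_derive_upd x a (x a); rewrite /chris_v; apply: is_derive_eqR.
  by repeat (derive_tac; try apply: is_derive_df).
by rewrite /= upd_id; ring.
Qed.

Lemma pd_Gam_cv0 x (a b c : I) :
  pd (fun z => Gam (gF k eps F) z b c cv0) a x =
  rsum (fun i : 'I_k =>
    2 * df 2 i (x (cu i)) * basis a (cu i) * x (cs i) * (basis b (cu i) * basis c (cu i))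
    + (2 * df 1 i (x (cu i)) + 1) * basis a (cs i) * (basis b (cu i) * basis c (cu i))
    + df 1 i (x (cu i)) * basis a (cu i)
      * (basis b (cu i) * basis c (cs i) + basis b (cs i) * basis c (cu i))).
Proof.
apply: pd_derive.
apply: (is_derive_ext (fun t => rsum (fun i : 'I_k => chris_v0 (upd x a t) (basis b) (basis c) i))).
  by move=> t; rewrite Gam_gF /chris vs_vec_cv0.
have Hg := is_derive_upd x a (x a); rewrite /chris_v0; apply: is_derive_eqR.
  by repeat (derive_tac; try apply: is_derive_df).
by apply: rsum_ext => i /=; rewrite upd_id; ring.
Qed.

Lemma pd_Gam_eq0 x (a b c f : I) (f0 : forall x v w, chris x v w f = 0) :
  pd (fun z => Gam (gF k eps F) z b c f) a x = 0.
Proof.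
apply: pd_derive; apply: (is_derive_ext (fun=> 0)); last exact: is_derive_cstR.
by move=> t; rewrite Gam_gF f0.
Qed.

Lemma lin_chris x v (c : I) : lin (fun w => chris x v w c).
Proof.
case: (indexP c) => [|i||i|i].
- by apply: (lin_ext (L1 := fun w => 0 * w c)) => [w|]; [rewrite /chris vs_vec_cu0; ring | lin_tac].
- by apply: (lin_ext (L1 := fun w => 0 * w c)) => [w|]; [rewrite /chris vs_vec_cu; ring | lin_tac].
- apply: (lin_ext (L1 := fun w => rsum (fun i : 'I_k => chris_v0 x v w i))) => [w|].
    by rewrite /chris vs_vec_cv0.
  by rewrite /chris_v0; lin_tac.
- apply: (lin_ext (L1 := fun w => chris_v x v w i)) => [w|]; first by rewrite /chris vs_vec_cv.
  by rewrite /chris_v; lin_tac.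
- apply: (lin_ext (L1 := fun w => chris_s x v w i)) => [w|]; first by rewrite /chris vs_vec_cs.
  by rewrite /chris_s; lin_tac.
Qed.

Lemma Rup_gF x (a b c f : I) :
  Rup (gF k eps F) x a b c f = curv x (basis a) (basis b) (basis c) f.
Proof.
rewrite /Rup rsum_sub.
(* By linearity in the last argument, the quadratic terms of the curvature are iterated Christoffel
   fields. *)
have G (a' b' : I) : rsum (fun e => Gam (gF k eps F) x b' c e * Gam (gF k eps F) x a' e f)
    = chris x (basis a') (chris x (basis b') (basis c)) f.
  rewrite (lin_chris x (basis a') f); apply: rsum_ext => e.
  by rewrite !Gam_gF.
rewrite !G.
have GX0 x' v w : chris x' v w cu0 = 0 by rewrite /chris vs_vec_cu0.
have GX (i : 'I_k) x' v w : chris x' v w (cu i) = 0 by rewrite /chris vs_vec_cu.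
case: (indexP f) => [|i||i|i].
- by rewrite !pd_Gam_eq0 // !GX0 /curv vs_vec_cu0; ring.
- by rewrite !pd_Gam_eq0 // !GX /curv vs_vec_cu; ring.
- rewrite !pd_Gam_cv0 {1 3}/chris !vs_vec_cv0 /curv vs_vec_cv0 -!rsum_sub -rsum_add; apply: rsum_ext => i.
  by rewrite /chris_v0 /curv_v0 /chris !vs_vecE /chris_s /omega /eta; ring.
- rewrite !pd_Gam_cv {1 3}/chris !vs_vec_cv /curv vs_vec_cv /chris_v /curv_v /chris !vs_vecE /chris_s /omega /eta; ring.
- rewrite !pd_Gam_cs {1 3}/chris !vs_vec_cs /curv vs_vec_cs /curv_s /chris_s /chris !vs_vecE /chris_s /omega /eta; ring.
Qed.

Lemma Rlow_gF x (a b c d : I) :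
  Rlow (gF k eps F) x a b c d =
  rsum (fun i : 'I_k =>
    (1 + df 1 i (x (cu i))) *
      (omega (basis a) (basis b) i * eta (basis c) (basis d) i
       + eta (basis a) (basis b) i * omega (basis c) (basis d) i)
    + (- sign i * df 0 i (x (cu i)) ^ 2) *
      (omega (basis a) (basis b) i * omega (basis c) (basis d) i)).
Proof.
transitivity (gform_F x (curv x (basis a) (basis b) (basis c)) (basis d)).
  rewrite (lin_gform_Fl x (basis d)); apply: rsum_ext => f.
  by rewrite Rup_gF gFE.
rewrite gform_F_vs_vec -rsum_mulr -rsum_add; apply: rsum_ext => i.
have s2 := sign_sq i.
rewrite /curv_v0 /curv_v /curv_s /omega /eta.
ring [s2].
Qed.

(** * Iterated covariant derivatives of the curvature *)

Definition coef_a (l i : nat) (t : R) : R := (if l is 0 then 1 else 0) + df l.+1 i t.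

(* The correction term comes from nabla ds_i = sign i * df 0 i * (du_0 du_i + du_i du_0) + ..., which turns eta_i into a multiple of omega_i. *)
Fixpoint coef_b (l i : nat) : R -> R :=
  if l is l'.+1 then fun t => Derive (coef_b l' i) t - 2 * sign i * df 0 i t * coef_a l' i t
  else fun t => - sign i * (df 0 i t * df 0 i t).

Lemma is_derive_coef_a l (i : 'I_k) t : is_derive (coef_a l i) t (coef_a l.+1 i t).
Proof.
apply: is_derive_addR (is_derive_df _ _ _).
by case: l => [|l]; apply: is_derive_cstR.
Qed.

(* [coef_b] is never made explicit: only its repeated differentiability matters. *)
Inductive df_poly (i : nat) : (R -> R) -> Prop :=
  | DfPolyDf n : df_poly i (df n i)
  | DfPolyCst c : df_poly i (fun=> c)
  | DfPolyAdd f g : df_poly i f -> df_poly i g -> df_poly i (fun t => f t + g t)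
  | DfPolyMul f g : df_poly i f -> df_poly i g -> df_poly i (fun t => f t * g t).

Lemma df_poly_derive (i : 'I_k) f : df_poly i f ->
  exists2 f', df_poly i f' & forall t, is_derive f t (f' t).
Proof.
elim=> {f} [n|c|f g _ [f' pf df'] _ [g' pg dg']|f g pf [f' pf' df'] pg [g' pg' dg']].
- by exists (df n.+1 i) => [|t]; [constructor | apply: is_derive_df].
- by exists (fun=> 0) => [|t]; [constructor | apply: is_derive_cstR].
- exists (fun t => f' t + g' t) => [|t]; first by constructor.
  exact: is_derive_addR.
- exists (fun t => f' t * g t + f t * g' t) => [|t].
    by do 2!constructor.
  exact: is_derive_mulR.
Qed.

Lemma df_poly_Derive (i : 'I_k) f : df_poly i f -> df_poly i (Derive f).
Proof.
case/df_poly_derive => f' pf' df'.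
suff -> : Derive f = f' by [].
by apply: functional_extensionality => t; apply: is_derive_unique.
Qed.

Lemma df_poly_coef_b l (i : 'I_k) : df_poly i (coef_b l i).
Proof.
elim: l => [|l IH] /=.
  by apply: DfPolyMul; [|apply: DfPolyMul]; constructor.
suff -> : (fun t => Derive (coef_b l i) t - 2 * sign i * df 0 i t * coef_a l i t) =
  (fun t => Derive (coef_b l i) t
     + (-2 * sign i) * (df 0 i t * ((if l is 0 then 1 else 0) + df l.+1 i t))).
  apply: DfPolyAdd; first exact: df_poly_Derive.
  apply: DfPolyMul; first by constructor.
  apply: DfPolyMul; first by constructor.
  by apply: DfPolyAdd; constructor.
by apply: functional_extensionality => t; rewrite /coef_a; ring.
Qed.

Lemma is_derive_coef_b l (i : 'I_k) t : is_derive (coef_b l i) t (Derive (coef_b l i) t).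
Proof.
by case: (df_poly_derive (df_poly_coef_b l i)) => f' _ H; apply: Derive_correct; exists (f' t).
Qed.

(** The tensor power of du_i, evaluated on the direction slots of the covariant derivative. *)
Definition prod_cu (i : nat) (vs : seq V) : R := foldr (fun v r => v (cu i) * r) 1 vs.

Lemma prod_cu_cat i vs ws : prod_cu i (vs ++ ws) = prod_cu i vs * prod_cu i ws.
Proof. by elim: vs => [|v vs IH] /=; rewrite ?IH; ring. Qed.

Lemma prod_cu_eq0 i vs n z : (n < size vs)%N -> nth z vs n (cu i) = 0 -> prod_cu i vs = 0.
Proof.
elim: vs n => [|v vs IH] [|n] //= lt; first by move=> ->; ring.
by move=> /(IH n lt) ->; ring.
Qed.

Definition nablaR_term (A B : R) (i : nat) (vs : seq V) : R :=
  match vs with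
  | u :: v :: w :: z :: ys =>
      (A * (omega u v i * eta w z i + eta u v i * omega w z i) + B * (omega u v i * omega w z i))
      * prod_cu i ys
  | _ => 0
  end.

Definition nablaR_form (A B : nat -> R) (vs : seq V) : R :=
  rsum (fun i : 'I_k => nablaR_term (A i) (B i) i vs).

Lemma lin_cst0 : lin (fun _ : V => 0).
Proof. by move=> v; rewrite rsum_zero // => a; ring. Qed.

Lemma lin_nablaR_term A B (i : nat) pre post : lin (fun v => nablaR_term A B i (pre ++ v :: post)).
Proof.
case: pre => [|u1 [|u2 [|u3 [|u4 pre]]]] /=.
- by case: post => [|v1 [|v2 [|v3 post]]]; try exact: lin_cst0; rewrite /omega /eta; lin_tac.
- by case: post => [|v1 [|v2 post]]; try exact: lin_cst0; rewrite /omega /eta; lin_tac.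
- by case: post => [|v1 post]; try exact: lin_cst0; rewrite /omega /eta; lin_tac.
- by rewrite /omega /eta; lin_tac.
apply: lin_mull.
apply: (lin_ext (L1 := fun v => prod_cu i pre * (v (cu i) * prod_cu i post))).
  by move=> v; rewrite prod_cu_cat.
by lin_tac.
Qed.

Lemma lin_nablaR_form A B pre post : lin (fun v => nablaR_form A B (pre ++ v :: post)).
Proof. by apply: lin_rsum => i; apply: lin_nablaR_term. Qed.

Lemma evalT_ext (T T' : seq I -> R) (vs : seq V) :
  (forall es, size es = size vs -> T es = T' es) -> evalT T vs = evalT T' vs.
Proof.
elim: vs T T' => [|v vs IH] T T' H /=; first exact: H.
apply: rsum_ext => e; congr (_ * _); apply: IH => es Hes.
by apply: H; rewrite /= Hes.
Qed.

(** The slots are expanded one after another; the induction carries the prefix [pre] of slots that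
    already hold basis vectors. *)
Lemma evalT_multilinear (T : seq V -> R) (vs : seq V) :
  (forall pre post, lin (fun v => T (pre ++ v :: post))) ->
  evalT (fun es => T (map basis es)) vs = T vs.
Proof.
move=> H; suff E pre : evalT (fun es => T (pre ++ map basis es)) vs = T (pre ++ vs).
  exact: (E [::]).
elim: vs pre => [|v vs IH] pre //=.
rewrite (H pre vs v); apply: rsum_ext => e; congr (_ * _).
rewrite -cat_rcons -IH.
by apply: evalT_ext => es _; rewrite cat_rcons.
Qed.

Lemma rsum_chris_nablaR_form A B x u v pre post :
  rsum (fun e => chris x u v e * nablaR_form A B (pre ++ basis e :: post)) =
  nablaR_form A B (pre ++ chris x u v :: post).
Proof. by rewrite (lin_nablaR_form A B pre post (chris x u v)). Qed.

(** Induction on l. Differentiating the coefficients along y produces the factor du_i(y). Since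
    [chris] has no u-components, the Christoffel corrections leave [omega] and the direction slots
    alone; the two corrections of [eta u v i] add up to sign i * f_i * du_i(y) * [omega u v i],
    which accounts for the correction in [coef_b]. *)
Lemma nablaR_gF l x xs : size xs = (4 + l)%N ->
  nablaR (gF k eps F) l x xs =
  nablaR_form (fun i => coef_a l i (x (cu i))) (fun i => coef_b l i (x (cu i))) (map basis xs).
Proof.
elim: l x xs => [|l IH] x xs.
  case: xs => [|a [|b [|c [|d [|? ?]]]]] // _.
  rewrite /= Rlow_gF; apply: rsum_ext => i /=; rewrite /coef_a; ring.
case/lastP: xs => [//|xs y]; rewrite size_rcons => -[Hs].
rewrite /nablaR /= -/(nablaR _ l) /covD rev_rcons revK.
have -> : pd (fun z => nablaR (gF k eps F) l z xs) y x =
   rsum (fun i : 'I_k => basis y (cu i) *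
     nablaR_term (coef_a l.+1 i (x (cu i))) (Derive (coef_b l i) (x (cu i))) i (map basis xs)).
  apply: pd_derive.
  apply: (is_derive_ext (fun t => nablaR_form (fun i => coef_a l i (upd x y t (cu i)))
     (fun i => coef_b l i (upd x y t (cu i))) (map basis xs))).
    by move=> t; rewrite IH.
  apply: is_derive_rsum => i.
  case: xs Hs => [|a [|b [|c [|d ws]]]] // _ /=.
  have HA := @is_derive_coef_a l i; have HB := @is_derive_coef_b l i.
  have Hg := is_derive_upd x y (x y).
  apply: is_derive_eqR; first by derive_tac.
  by rewrite /= upd_id; ring.
(* Hence a correction in a direction slot vanishes: either the Christoffel component is zero or d_e
   contributes a zero factor to [prod_cu]. *)
have Gz (e : I) z w : (chris x z w e = 0) \/ (forall i : 'I_k, basis e (cu i) = 0).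
  case: (indexP e) => [|i||i|i]; [left|left|right|right|right]; rewrite ?/chris ?vs_vecE // => *;
  by rewrite !basis_val.
have IHset p e : (p < size xs)%N ->
    nablaR (gF k eps F) l x (set_nth y xs p e) =
    nablaR_form (fun i => coef_a l i (x (cu i))) (fun i => coef_b l i (x (cu i)))
      (map basis (set_nth y xs p e)).
  by move=> lt; rewrite IH // size_set_nth Hs (maxn_idPr _) // -Hs.
have -> : \big[Rplus/0]_(p < size xs)
    rsum (fun e => Gam (gF k eps F) x y (nth y xs p) e *
      nablaR (gF k eps F) l x (set_nth y xs p e)) =
    \big[Rplus/0]_(p < size xs)
    rsum (fun e => chris x (basis y) (basis (nth y xs p)) e *
      nablaR_form (fun i => coef_a l i (x (cu i))) (fun i => coef_b l i (x (cu i)))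
      (map basis (set_nth y xs p e))).
  by apply: eq_bigr => p _; apply: rsum_ext => e; rewrite Gam_gF IHset.
case: xs Hs {IHset} => [|a [|b [|c [|d ws]]]] //= [Hs].
(* The four curvature slots are split off; the remaining positions are direction slots. *)
rewrite !big_ord_recl /= big1; last first.
  move=> p _; apply: rsum_zero => e.
  have [->|ez] := Gz e (basis y) (basis (nth y ws p)); first by ring.
  rewrite (_ : nablaR_form _ _ _ = 0); first by ring.
  apply: rsum_zero => i /=.
  rewrite (@prod_cu_eq0 _ _ p (fun=> 0)); first by ring.
    by rewrite size_map size_set_nth; apply: leq_trans (ltn_ord p) (leq_maxr _ _).
  rewrite (nth_map y); last by rewrite size_set_nth; apply: leq_trans (ltn_ord p) (leq_maxr _ _).
  by rewrite nth_set_nth /= eqxx.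
rewrite (rsum_chris_nablaR_form _ _ x _ _ [::]) (rsum_chris_nablaR_form _ _ x _ _ [:: basis a])
  (rsum_chris_nablaR_form _ _ x _ _ [:: basis a; basis b])
  (rsum_chris_nablaR_form _ _ x _ _ [:: basis a; basis b; basis c]) /=.
rewrite Rplus_0_r /nablaR_form -3!rsum_add -rsum_sub; apply: rsum_ext => i /=.
rewrite map_rcons -cats1 prod_cu_cat /omega /eta /chris !vs_vecE /chris_s /=; ring.
Qed.

Lemma evalT_nablaR_gF l x vs : size vs = (4 + l)%N ->
  evalT (nablaR (gF k eps F) l x) vs =
  nablaR_form (fun i => coef_a l i (x (cu i))) (fun i => coef_b l i (x (cu i))) vs.
Proof.
move=> Hs; rewrite -(evalT_multilinear vs (lin_nablaR_form _ _)).
by apply: evalT_ext => es Hes; rewrite nablaR_gF // Hes.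
Qed.

End Metric.

(** * The summands of beta and their invariance under rescaling *)

Definition beta_term (F : nat -> R -> R) (l i : nat) (t : R) : R :=
  coef_a F l i t * coef_a F 0 i t ^ (l - 1) / coef_a F 1 i t ^ l.

Lemma beta_rsum k F l (x : vec (dimF k)) : (0 < l)%N ->
  beta k F l x = rsum (fun i : 'I_k => beta_term F l i (x (cu k i))).
Proof.
case: l => // l _; rewrite /beta big_add1 big_mkord; apply: eq_bigr => i _.
by rewrite /beta_term /coef_a /df !Rplus_0_l.
Qed.

Lemma coef_a0_neq0 k F (i : 'I_k) t : admissible k F -> coef_a F 0 i t <> 0.
Proof.
move=> /(_ i.+1 (ltn_ord i)) [_ [H _]].
by rewrite /coef_a /df Rplus_comm; apply: H.
Qed.

Lemma coef_a1_neq0 k F (i : 'I_k) t : admissible k F -> coef_a F 1 i t <> 0.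
Proof.
move=> /(_ i.+1 (ltn_ord i)) [_ [_ H]].
by rewrite /coef_a /df Rplus_0_l; apply: H.
Qed.

(** With c = m d / o the hypotheses say b_p = c d^p a_p for p = 0, 1, l. The numerator is then
    multiplied by c d^l c^(l-1) and the denominator by (c d)^l, which agree. Nonvanishing of b0
    forces m and d to be nonzero. *)
Lemma beta_ratio (l : nat) (a0 a1 al b0 b1 bl o m d : R) :
  (0 < l)%N -> o <> 0 -> b0 <> 0 -> a1 <> 0 ->
  b0 * o = a0 * (m * d) -> b1 * o = a1 * (m * d) * d ->
  bl * o = al * (m * d) * d ^ l ->
  al * a0 ^ (l - 1) / a1 ^ l = bl * b0 ^ (l - 1) / b1 ^ l.
Proof.
case: l => // l _ o0 b00 a10 E0 E1 El; rewrite subn1 /=.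
have md0 : m * d <> 0.
  move=> z; rewrite z Rmult_0_r in E0.
  by case/Rmult_integral: E0.
have d0 : d <> 0 by move=> z; apply: md0; rewrite z; ring.
have -> : b0 = (m * d / o) * a0 by apply: (Rmult_eq_reg_r o) => //; rewrite E0; field.
have -> : b1 = (m * d / o) * d * a1 by apply: (Rmult_eq_reg_r o) => //; rewrite E1; field.
have -> : bl = (m * d / o) * d ^ l.+1 * al.
  by apply: (Rmult_eq_reg_r o) => //; rewrite El /=; field.
have m0 : m <> 0 by move=> z; apply: md0; rewrite z; ring.
have io0 := Rinv_neq_0_compat o o0.
rewrite !Rpow_mult_distr /=.
by field; do !split => //; apply: pow_nonzero.
Qed.

(** An injective self-map of a finite set is a permutation and may reindex the sum. *)
Lemma beta_eq_of_matching k F F' l (P Q : vec (dimF k)) (s : 'I_k -> 'I_k) :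
  (0 < l)%N -> injective s ->
  (forall j : 'I_k, beta_term F l j (P (cu k j)) = beta_term F' l (s j) (Q (cu k (s j)))) ->
  beta k F l P = beta k F' l Q.
Proof.
move=> l0 s_inj E; rewrite !beta_rsum // /rsum.
by rewrite [RHS](reindex_inj s_inj); apply: eq_bigr => j _; apply: E.
Qed.

(** * Invariance under isomorphisms of models *)

Section ModelInvariance.
Variables (k : nat) (eps : nat -> R) (F F' : nat -> R -> R).
Hypothesis eps_signs : signs k eps.
Hypothesis F_adm : admissible k F.
Hypothesis F'_adm : admissible k F'.
Local Notation V := (vec (dimF k)).
Local Notation cu0 := (cu0 k).
Local Notation cu := (cu k).
Local Notation cv0 := (cv0 k).
Local Notation cv := (cv k).
Local Notation cs := (cs k).
Variables (P Q : V) (L L' : V -> V) (l : nat).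
Hypothesis LL' : forall v, L (L' v) = v.
Hypothesis L_isom : forall v w, gform_F eps F' Q (L v) (L w) = gform_F eps F P v w.
Local Notation TP p := (nablaR_form (fun i => coef_a F p i (P (cu i))) (fun i => coef_b eps F p i (P (cu i)))).
Local Notation TQ p := (nablaR_form (fun i => coef_a F' p i (Q (cu i))) (fun i => coef_b eps F' p i (Q (cu i)))).
Hypothesis L_nablaR : forall p (vs : seq V), (p <= l)%N -> size vs = (4 + p)%N ->
  TQ p (map L vs) = TP p vs.

Lemma coef_aP_neq0 (i : 'I_k) : coef_a F 0 i (P (cu i)) <> 0. Proof. exact: coef_a0_neq0. Qed.
Lemma coef_aQ_neq0 (i : 'I_k) : coef_a F' 0 i (Q (cu i)) <> 0. Proof. exact: coef_a0_neq0. Qed.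

(** Such a v lies in the span of the d_v, hence in the kernel of R, and so R also vanishes when
    [L' v] is inserted. Testing against d_(u_j), d_(u_j), d_(s_j) isolates the u_0-component of
    [L' v]; once this is zero, a second test isolates the s_j-component. Both use 1 + f_j'
    nonzero. *)
Lemma kernel_cs (v : V) (j : 'I_k) :
  v cu0 = 0 -> (forall i : 'I_k, v (cu i) = 0) -> (forall i : 'I_k, v (cs i) = 0) ->
  L' v (cs j) = 0.
Proof.
move=> v0 vX vS.
have T1 : TP 0 [:: L' v; basis (cu j); basis (cu j); basis (cs j)] = 0.
  rewrite -L_nablaR //= LL' /nablaR_form rsum_zero // => i /=.
  by rewrite /omega /eta v0 vX vS; ring.
have T2 : TP 0 [:: basis cu0; basis (cu j); basis (cu j); L' v] = 0.
  rewrite -L_nablaR //= LL' /nablaR_form rsum_zero // => i /=.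
  by rewrite /omega /eta v0 vX vS; ring.
have w0 : L' v cu0 = 0.
  move: T1; rewrite /nablaR_form (rsum_pick j) => [|i ij] /=; rewrite /omega /eta !basis_val.
    rewrite eqxx => T1; apply: (Rmult_eq_reg_l (coef_a F 0 j (P (cu j)))); last exact: coef_aP_neq0.
    by rewrite Rmult_0_r -[RHS]T1; ring.
  by rewrite (negbTE ij); ring.
move: T2; rewrite /nablaR_form (rsum_pick j) => [|i ij] /=; rewrite /omega /eta !basis_val.
  rewrite eqxx w0 => T2; apply: (Rmult_eq_reg_l (coef_a F 0 j (P (cu j)))); last exact: coef_aP_neq0.
  by rewrite Rmult_0_r -[RHS]T2; ring.
by rewrite (negbTE ij); ring.
Qed.

(** A u-component is a pairing with some d_v = [L (L' d_v)]. By isometry it becomes a pairing of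
    d_(s_j) with [L' d_v], which has no s-components. The same argument serves for the u_i. *)
Lemma image_cs_cu0 (j : 'I_k) : L (basis (cs j)) cu0 = 0.
Proof.
rewrite -(gform_F_cv0 eps F' Q) -(LL' (basis cv0)) L_isom gform_F_sym gform_F_cs kernel_cs => *;
by rewrite ?basis_val; ring.
Qed.

Lemma image_cs_cu (i j : 'I_k) : L (basis (cs j)) (cu i) = 0.
Proof.
rewrite -(gform_F_cv eps F' Q) -(LL' (basis (cv i))) L_isom gform_F_sym gform_F_cs kernel_cs => *;
by rewrite ?basis_val; ring.
Qed.

Local Notation o i j := (L (basis (cs j)) (cs i)).
Local Notation d i j := (L' (basis (cu i)) (cu j)).
Local Notation mu i j := (omega (L' (basis cu0)) (L' (basis (cu i))) j).

(** Without u-components only the s-part of the metric contributes, so the s-block of [L] is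
    orthogonal for the signs. *)
Lemma gform_F_image_cs (i j : 'I_k) :
  rsum (fun h : 'I_k => sign eps h * (o h i * o h j)) = gform_F eps F P (basis (cs i)) (basis (cs j)).
Proof.
rewrite -L_isom /gform_F !image_cs_cu0 !Rmult_0_l !Rplus_0_l Rmult_0_r Rplus_0_l.
by apply: rsum_ext => h; rewrite /gform_F_term !image_cs_cu0 !image_cs_cu; ring.
Qed.

Lemma prod_cu_nseq (j : 'I_k) n (v : V) : prod_cu j (nseq n v) = v (cu j) ^ n.
Proof. by elim: n => [|n IH] //=; rewrite IH. Qed.

(** The p-th covariant derivative of R is evaluated at both points on corresponding vectors. The
    fourth slot holds a vector without u-components, on which [omega] vanishes, so the [coef_b]
    terms disappear; the p direction slots contribute the p-th power. *)
Lemma coefficient_relation p (i i' j : 'I_k) : (p <= l)%N ->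
  (if i' == i then coef_a F' p i (Q (cu i)) * o i j else 0) =
  coef_a F p j (P (cu j)) * (mu i j * d i' j) * d i j ^ p.
Proof.
move=> pl.
transitivity (TP p [:: L' (basis cu0), L' (basis (cu i)), L' (basis (cu i')), basis (cs j)
    & nseq p (L' (basis (cu i)))]).
  rewrite -L_nablaR //=; last by rewrite size_nseq.
  rewrite map_nseq !LL' /nablaR_form (rsum_pick i) => [|h hi] /=.
    rewrite prod_cu_nseq /omega /eta !basis_val eqxx pow1 !image_cs_cu image_cs_cu0.
    by rewrite eq_sym; case: eqP => _; ring.
  by rewrite /omega /eta !basis_val (negbTE hi); ring.
rewrite /nablaR_form (rsum_pick j) => [|h hj] /=.
  by rewrite prod_cu_nseq /omega /eta !basis_val eqxx; ring.
by rewrite /omega /eta !basis_val (negbTE hj); ring.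
Qed.

Lemma model_beta : (0 < l)%N -> beta k F l P = beta k F' l Q.
Proof.
move=> l0.
(* Otherwise the image of d_(s_j) would be null, whereas d_(s_j) has square length 1 or -1. *)
have ex (j : 'I_k) : exists i : 'I_k, o i j <> 0.
  case: (boolP [forall i : 'I_k, o i j == 0]) => [/forallP H|].
    exfalso; have := gform_F_image_cs j j; rewrite rsum_zero => [|h].
      by rewrite gform_F_cs !basis_val eqxx Rmult_1_r; move/esym; apply: sign_neq0.
    by rewrite (eqP (H h)); ring.
  by case/forallPn => i /eqP; exists i.
have [s Hs] := fin_all_exists ex.
(* The relation for p = 0, read as a matrix in (i, i'), equates a diagonal matrix with the rank-one
   matrix of the products mu i j * d i' j. Two nonzero diagonal entries would force a nonzero
   off-diagonal one. *)
have uniq (i j : 'I_k) : o i j <> 0 -> i = s j.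
  move=> oij; apply/eqP; apply: contraT => /negbTE ne; exfalso.
  have := coefficient_relation i i j (leq0n l).
  have := coefficient_relation (s j) i j (leq0n l).
  rewrite ne eqxx /= !Rmult_1_r => E1 E2.
  have := coefficient_relation (s j) (s j) j (leq0n l).
  rewrite eqxx /= Rmult_1_r => E3.
  have m0 : mu (s j) j <> 0.
    move=> z; move: E3; rewrite z Rmult_0_l Rmult_0_r => /Rmult_integral [].
      exact: coef_aQ_neq0.
    exact: Hs.
  have d0 : d i j <> 0.
    move=> z; move: E2; rewrite z !Rmult_0_r => /Rmult_integral [] //.
    exact: coef_aQ_neq0.
  move/esym: E1 => /Rmult_integral [|/Rmult_integral []] //.
  exact: coef_aP_neq0.
(* If s i = s j with i different from j, the orthogonality of two columns of the s-block reduces to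
   a single nonzero product. *)
have s_inj : injective s.
  move=> i j sij; apply/eqP; apply: contraT => /negbTE ne; exfalso.
  have := gform_F_image_cs i j; rewrite gform_F_cs basis_val eq_sym ne Rmult_0_r.
  rewrite (rsum_pick (s i)) => [|h /eqP hi].
    move=> /Rmult_integral []; first exact: sign_neq0.
    by move=> /Rmult_integral []; [|rewrite sij]; apply: Hs.
  case: (eqVneq (o h i) 0) => [->|/eqP nz]; first by ring.
  by case: hi; apply: uniq.
apply: (beta_eq_of_matching (s := s)) => // j.
have R p (pl : (p <= l)%N) := coefficient_relation (s j) (s j) j pl.
move: (R 0%N (leq0n l)) (R 1%N l0) (R l (leqnn l)); rewrite eqxx /= !Rmult_1_r => R0 R1 Rl.
apply: (beta_ratio _ _ _ _ R0 R1 Rl) => //; first exact: coef_a0_neq0.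
exact: coef_a1_neq0.
Qed.

End ModelInvariance.

Lemma linmap_comp N (A B : 'M[R]_N) v : linmap A (linmap B v) = linmap (B *m A)%R v.
Proof.
apply: functional_extensionality => b; rewrite /linmap.
transitivity (rsum (fun a => rsum (fun c => v c * B c a * A a b))).
  by apply: rsum_ext => a; rewrite -rsum_mulr.
rewrite rsum_swap; apply: rsum_ext => c.
rewrite mxE -[RHS]rsum_mull; apply: rsum_ext => a; exact: Rmult_assoc.
Qed.

Lemma linmap1 N (v : vec N) : linmap 1%:M%R v = v.
Proof.
apply: functional_extensionality => b; rewrite /linmap (rsum_pick b) => [|a ab].
  by rewrite mxE eqxx; apply: Rmult_1_r.
by rewrite mxE (negbTE ab); apply: Rmult_0_r.
Qed.

Lemma admissible_smooth k F : admissible k F ->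
  forall (i : 'I_k) n t, ex_derive_n (F i.+1) n t.
Proof. by move=> H i n t; have [Hs _] := H i.+1 (ltn_ord i); apply: Hs. Qed.

Lemma model_iso_beta k eps F F' l (P Q : vec (dimF k)) M :
  signs k eps -> admissible k F -> admissible k F' -> (0 < l)%N ->
  model_iso (gF k eps F) (gF k eps F') l P Q M -> beta k F l P = beta k F' l Q.
Proof.
move=> He HF HF' l0 [Mu [Mg MR]].
apply: (@model_beta k eps F F' He HF HF' P Q (linmap M) (linmap (invmx M)) l) => //.
- by move=> v; rewrite linmap_comp mulVmx // linmap1.
- by move=> v w; rewrite -!gformE.
- move=> p vs pl Hs.
  rewrite -!(evalT_nablaR_gF He (admissible_smooth HF)) -?(evalT_nablaR_gF He (admissible_smooth HF')) ?size_map //.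
  exact: MR.
Qed.

Lemma upd_eq N (x : vec N) a t : upd x a t a = t.
Proof. by rewrite /upd eqxx. Qed.

Lemma upd_ne N (x : vec N) a b t : b != a -> upd x a t b = x b.
Proof. by rewrite /upd => /negbTE ->. Qed.

Lemma upd_upd N (x : vec N) a t t' : upd (upd x a t) a t' = upd x a t'.
Proof. by apply: functional_extensionality => c; rewrite /upd; case: eqP. Qed.

Lemma upd_comm N (x : vec N) a b t t' : a != b ->
  upd (upd x a t) b t' = upd (upd x b t') a t.
Proof.
move=> /eqP ab; apply: functional_extensionality => c; rewrite /upd.
by case: eqP => // ->; case: eqP => // E; case: ab.
Qed.

Lemma lin_addv N (L : vec N -> R) v w : lin L -> L (fun c => v c + w c) = L v + L w.
Proof. by move=> H; rewrite (H (fun c => _)) (H v) (H w) -rsum_add; apply: rsum_ext => a; ring. Qed.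

(** * Partial derivatives on open sets *)

Section Calculus.
Variables (N : nat) (U : vec N -> Prop).
Hypothesis U_open : Defs.open_set U.

Lemma smooth_pd h a : smooth_on U h -> smooth_on U (pd h a).
Proof.
(* [ipd] differentiates first along the last entry of its list. *)
move=> H s x Ux; have := H (rcons s a) x Ux.
by rewrite /ipd foldr_rcons.
Qed.

Lemma is_derive_smooth h a x : smooth_on U h -> U x ->
  is_derive (fun t => h (upd x a t)) (x a) (pd h a x).
Proof. by move=> H Ux; apply: Derive_correct; have [_] := H [::] x Ux; apply. Qed.

Lemma locally_upd x a : U x -> locally (x a) (fun t => U (upd x a t)).
Proof.
move=> /U_open [d [d0 H]]; exists (mkposreal d d0) => t Ht; apply: H => c.
rewrite /upd; case: eqP => [->|_]; first exact: Ht.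
by rewrite Rminus_diag Rabs_R0.
Qed.

(** This allows an identity that holds only on the open set [U] to be differentiated. *)
Lemma pd_on h1 h2 a x d : (forall y, U y -> h1 y = h2 y) -> U x ->
  is_derive (fun t => h2 (upd x a t)) (x a) d -> pd h1 a x = d.
Proof.
move=> E Ux H; apply: pd_derive; apply: is_derive_ext_loc H.
by apply: filter_imp (locally_upd a Ux) => t Ut; rewrite E.
Qed.

(** Schwarz's theorem in two variables, applied to h restricted to the coordinate plane through x in
    the directions a and b. *)
Lemma pd_comm h a b x : smooth_on U h -> U x ->
  pd (pd h a) b x = pd (pd h b) a x.
Proof.
move=> H Ux; case: (eqVneq a b) => [->//|ab].
pose y u v := upd (upd x a u) b v.
have yb u v : y u v b = v by rewrite /y upd_eq.
have ya u v : y u v a = u by rewrite /y upd_ne // upd_eq.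
have yy : y (x a) (x b) = x by rewrite /y !upd_id.
have updb u v t : upd (y u v) b t = y u t by rewrite /y upd_upd.
have upda u v t : upd (y u v) a t = y t v.
  by rewrite /y -upd_comm ?upd_upd.
have Db g u v : Derive (fun t => g (y u t)) v = pd g b (y u v).
  by rewrite /pd yb; apply: Derive_ext => t; rewrite updb.
have Da g u v : Derive (fun t => g (y t v)) u = pd g a (y u v).
  by rewrite /pd ya; apply: Derive_ext => t; rewrite upda.
have exb g u v : smooth_on U g -> U (y u v) -> ex_derive (fun t => g (y u t)) v.
  move=> Hg Uy; exists (pd g b (y u v)).
  have := is_derive_smooth b Hg Uy; rewrite yb; apply: is_derive_ext => t.
  by rewrite updb.
have exa g u v : smooth_on U g -> U (y u v) -> ex_derive (fun t => g (y t v)) u.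
  move=> Hg Uy; exists (pd g a (y u v)).
  have := is_derive_smooth a Hg Uy; rewrite ya; apply: is_derive_ext => t.
  by rewrite upda.
have box u v d : 0 < d -> Rabs (u - x a) < d -> Rabs (v - x b) < d -> box_ball x d (y u v).
  move=> d0 Hu Hv c; rewrite /y /upd; case: eqP => [->//|_]; case: eqP => [->//|_].
  by rewrite Rminus_diag Rabs_R0.
have Ha u v : Derive (fun z => h (y z v)) u = pd h a (y u v) by apply: Da.
have Eab u v : Derive (fun z => Derive (fun t => h (y z t)) v) u = pd (pd h b) a (y u v).
  rewrite -Da; apply: Derive_ext => t; exact: Db.
have Eba u v : Derive (fun z => Derive (fun t => h (y t z)) u) v = pd (pd h a) b (y u v).
  rewrite -Db; apply: Derive_ext => t; exact: Da.
have cont g : cont_at g x -> continuity_2d_pt (fun u v => g (y u v)) (x a) (x b).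
  move=> Hg e; have [d [d0 Hd]] := Hg e (cond_pos e).
  exists (mkposreal d d0) => u v Hu Hv; rewrite yy; apply: Hd; exact: box.
have := @Schwarz (fun u v => h (y u v)) (x a) (x b).
rewrite Eab Eba yy => -> //.
- have [d [d0 Hd]] := U_open Ux.
  exists (mkposreal d d0) => u v Hu Hv.
  have Uy : U (y u v) by apply: Hd; apply: box.
  split; [exact: exa|split; [exact: exb|split]].
    apply: (ex_derive_ext (fun t => pd h b (y t v))) => [t|]; first by rewrite -Db.
    by apply: exa => //; apply: smooth_pd.
  apply: (ex_derive_ext (fun t => pd h a (y u t))) => [t|]; first by rewrite -Da.
  by apply: exb => //; apply: smooth_pd.
- apply: (continuity_2d_pt_ext (fun u v => pd (pd h b) a (y u v))) => [u v|]; first by rewrite Eab.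
  by apply: cont; have [] := H [:: a; b] x Ux.
- apply: (continuity_2d_pt_ext (fun u v => pd (pd h a) b (y u v))) => [u v|]; first by rewrite Eba.
  by apply: cont; have [] := H [:: b; a] x Ux.
Qed.

End Calculus.

(** * Integrability of the Hessian equation *)

(* A component [h] of a local isometry satisfies the Hessian equation below; [K] is zero for the u-components and the pulled back Christoffel term [chris_s] for the s-components. *)
Section Hessian.
Variables (k : nat) (eps : nat -> R) (F : nat -> R -> R).
Hypothesis F_adm : admissible k F.
Local Notation I := 'I_(dimF k).
Local Notation V := (vec (dimF k)).
Local Notation cu0 := (cu0 k).
Local Notation cu := (cu k).
Local Notation cv0 := (cv0 k).
Local Notation cv := (cv k).
Local Notation cs := (cs k).
Variables (U : V -> Prop) (h : V -> R) (K : I -> I -> V -> R) (dK : I -> I -> I -> V -> R).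
Hypothesis U_open : Defs.open_set U.
Hypothesis h_smooth : smooth_on U h.
Hypothesis hessian : forall x a b, U x ->
  pd (pd h a) b x =
  rsum (fun c => chris eps F x (basis a) (basis b) c * pd h c x) - K a b x.
Hypothesis K_supp : forall x a b, U x -> a <> cu0 -> (forall i : 'I_k, a <> cu i) -> K a b x = 0.
Hypothesis is_derive_K : forall x a b c, U x ->
  is_derive (fun t => K a b (upd x c t)) (x c) (dK a b c x).
Hypothesis dK_cs : forall x (j : 'I_k), U x -> dK (cu j) (cu j) (cs j) x = 0.

Let Fs := admissible_smooth F_adm.
Let sm a := smooth_pd a h_smooth.

Lemma hessianE x a b : U x ->
  pd (pd h a) b x =
  rsum (fun i : 'I_k => chris_v0 F x (basis a) (basis b) i) * pd h cv0 x
  + rsum (fun i : 'I_k => chris_v F x (basis a) (basis b) i * pd h (cv i) x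
      + chris_s eps F x (basis a) (basis b) i * pd h (cs i) x) - K a b x.
Proof.
move=> Ux; rewrite hessian // rsum_index; congr (_ - _).
rewrite /chris !vs_vecE Rmult_0_l Rplus_0_l; congr (_ + _).
by apply: rsum_ext => i; rewrite !vs_vecE; ring.
Qed.

Let neS0 (j : 'I_k) : cs j <> cu0.
Proof. by move/(congr1 val); rewrite /= !vals; lia. Qed.
Let neSX (j i : 'I_k) : cs j <> cu i.
Proof. by have ? := ltn_ord i; move/(congr1 val); rewrite /= !vals; lia. Qed.
Let neY0 (j : 'I_k) : cv j <> cu0.
Proof. by move/(congr1 val); rewrite /= !vals; lia. Qed.
Let neYX (j i : 'I_k) : cv j <> cu i.
Proof. by have ? := ltn_ord i; move/(congr1 val); rewrite /= !vals; lia. Qed.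
Let neY00 : cv0 <> cu0.
Proof. by move/(congr1 val); rewrite /= !vals; lia. Qed.
Let neY0X (i : 'I_k) : cv0 <> cu i.
Proof. by have ? := ltn_ord i; move/(congr1 val); rewrite /= !vals; lia. Qed.

(** Christoffel fields with an argument d_v vanish, as does K there. The same holds for v_0. *)
Lemma hessian_cv x (j : 'I_k) b : U x -> pd (pd h (cv j)) b x = 0.
Proof.
move=> Ux; rewrite hessianE // K_supp //; rewrite !rsum_zero ?Rmult_0_l => [|i|i]; try ring;
by rewrite /chris_v0 /chris_v /chris_s !basis_val; ring.
Qed.

Lemma hessian_cv0 x b : U x -> pd (pd h cv0) b x = 0.
Proof.
move=> Ux; rewrite hessianE // K_supp //; rewrite !rsum_zero ?Rmult_0_l => [|i|i]; try ring;
by rewrite /chris_v0 /chris_v /chris_s !basis_val; ring.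
Qed.

Lemma hessian_cs_cu0 x (j : 'I_k) : U x -> pd (pd h (cs j)) cu0 x = df F 0 j (x (cu j)) * pd h (cv j) x.
Proof.
move=> Ux; rewrite hessianE // K_supp // rsum_zero => [|i]; last by rewrite /chris_v0 !basis_val; ring.
rewrite (rsum_pick j) => [|i ij]; rewrite /chris_v /chris_s !basis_val.
  by rewrite eqxx; ring.
by rewrite (negbTE ij); ring.
Qed.

Lemma hessian_cs_cu x (j : 'I_k) : U x ->
  pd (pd h (cs j)) (cu j) x = df F 0 j (x (cu j)) * pd h cv0 x - x cu0 * pd h (cv j) x.
Proof.
move=> Ux; rewrite hessianE // K_supp // !(rsum_pick j) => [|i ij|i ij].
- by rewrite /chris_v0 /chris_v /chris_s !basis_val ?eqxx; ring.
- by rewrite /chris_v /chris_s !basis_val (negbTE ij); ring.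
- by rewrite /chris_v0 !basis_val (negbTE ij); ring.
Qed.

Lemma hessian_cs_cs x (i j : 'I_k) : U x -> pd (pd h (cs i)) (cs j) x = 0.
Proof.
move=> Ux; rewrite hessianE // K_supp //; rewrite !rsum_zero ?Rmult_0_l => [|h'|h']; try ring;
by rewrite /chris_v0 /chris_v /chris_s !basis_val; ring.
Qed.

Lemma hessian_cu_cu x (j : 'I_k) : U x ->
  pd (pd h (cu j)) (cu j) x = (2 * df F 1 j (x (cu j)) + 1) * x (cs j) * pd h cv0 x
   + sign eps j * x cu0 * pd h (cs j) x - K (cu j) (cu j) x.
Proof.
move=> Ux; rewrite hessianE // !(rsum_pick j) => [|i ij|i ij].
- by rewrite /chris_v0 /chris_v /chris_s !basis_val ?eqxx; ring.
- by rewrite /chris_v /chris_s !basis_val (negbTE ij); ring.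
- by rewrite /chris_v0 !basis_val (negbTE ij); ring.
Qed.

(* Symmetry of the third derivatives d_(u_0) d_(u_j) d_(s_j) h. *)
Lemma pd_cv_eq0 x (j : 'I_k) : U x -> pd h (cv j) x = 0.
Proof.
move=> Ux; have := pd_comm U_open cu0 (cu j) (sm (cs j)) Ux.
have Hg a := is_derive_upd x a (x a).
have HY a := is_derive_smooth a (sm (cv j)) Ux.
have HY0 a := is_derive_smooth a (sm cv0) Ux.
have Hf := is_derive_df Fs 0 j.
rewrite (pd_on U_open (d := df F 1 j (x (cu j)) * pd h (cv j) x)
  (fun y Uy => hessian_cs_cu0 j Uy) Ux); last first.
  apply: is_derive_eqR; first by derive_tac.
  by rewrite /= upd_id hessian_cv // basis_val eqxx; ring.
rewrite (pd_on U_open (d := - pd h (cv j) x)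
  (fun y Uy => hessian_cs_cu j Uy) Ux); last first.
  apply: is_derive_eqR; first by derive_tac.
  by rewrite /= !upd_id hessian_cv0 // hessian_cv // !basis_val; ring.
(* With q = d_(v_j) h, the two orders of differentiation give f_j' q and -q, so (1 + f_j') q = 0. *)
move=> E; apply: (Rmult_eq_reg_l (coef_a F 0 j (x (cu j)))); last exact: (@coef_a0_neq0 k F j _ F_adm).
by rewrite Rmult_0_r /coef_a Rmult_plus_distr_r E; ring.
Qed.

(* Symmetry of the third derivatives d_(u_j) d_(u_j) d_(s_j) h. *)
Lemma pd_cv0_eq0 x : (0 < k)%N -> U x -> pd h cv0 x = 0.
Proof.
move=> k0 Ux; have [j _] : exists j : 'I_k, True by exists (Ordinal k0).
have := pd_comm U_open (cu j) (cs j) (sm (cu j)) Ux.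
have Hg a := is_derive_upd x a (x a).
have HY a := is_derive_smooth a (sm (cv j)) Ux.
have HY0 a := is_derive_smooth a (sm cv0) Ux.
have HS a := is_derive_smooth a (sm (cs j)) Ux.
have Hf p := is_derive_df Fs p j.
have HK c := is_derive_K (cu j) (cu j) c Ux.
rewrite (pd_on U_open (d := (2 * df F 1 j (x (cu j)) + 1) * pd h cv0 x)
  (fun y Uy => hessian_cu_cu j Uy) Ux); last first.
  apply: is_derive_eqR; first by derive_tac.
  by rewrite /= !upd_id hessian_cv0 // hessian_cs_cs // dK_cs // !basis_val eqxx; ring.
have hessian_cu_cs y : U y ->
    pd (pd h (cu j)) (cs j) y = df F 0 j (y (cu j)) * pd h cv0 y - y cu0 * pd h (cv j) y.
  by move=> Uy; rewrite (pd_comm U_open) // hessian_cs_cu.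
rewrite (pd_on U_open (d := df F 1 j (x (cu j)) * pd h cv0 x) hessian_cu_cs Ux); last first.
  apply: is_derive_eqR; first by derive_tac.
  by rewrite /= !upd_id hessian_cv0 // hessian_cv // !basis_val eqxx; ring.
move=> E; apply: (Rmult_eq_reg_l (coef_a F 0 j (x (cu j)))); last exact: (@coef_a0_neq0 k F j _ F_adm).
by rewrite Rmult_0_r /coef_a; move: E; lra.
Qed.

Hypothesis k_gt0 : (0 < k)%N.

(** Christoffel fields with an argument d_(s_j) have only v-components, and the v-derivatives of h
    vanish by now. *)
Lemma hessian_cs x (j : 'I_k) b : U x -> pd (pd h (cs j)) b x = 0.
Proof.
move=> Ux; rewrite hessianE // K_supp // pd_cv0_eq0 // Rmult_0_r rsum_zero => [|i]; first by ring.
by rewrite pd_cv_eq0 // /chris_s !basis_val; ring.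
Qed.

Lemma hessian_cu x a (i : 'I_k) : U x ->
  pd (pd h (cu i)) a x =
  sign eps i * (x cu0 * basis a (cu i) - df F 0 i (x (cu i)) * basis a cu0) * pd h (cs i) x
  - K (cu i) a x.
Proof.
move=> Ux; rewrite hessianE // pd_cv0_eq0 // Rmult_0_r (rsum_pick i) => [|j ji].
  by rewrite pd_cv_eq0 // /chris_s !basis_val eqxx; ring.
by rewrite pd_cv_eq0 // /chris_s !basis_val (negbTE ji); ring.
Qed.

(** Symmetry of the third derivatives d_(u_0) d_(u_j) d_(u_i) h. The curvature coefficient 1 + f_j'
    appears in front of d_(s_j) h and must be balanced by K; for K = 0 it forces d_(s_j) h = 0. *)
Lemma integrability x (i j : 'I_k) : U x ->
  (if j == i then sign eps j * coef_a F 0 j (x (cu j)) * pd h (cs j) x else 0) =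
  dK (cu i) (cu j) cu0 x - dK (cu i) cu0 (cu j) x.
Proof.
move=> Ux; have := pd_comm U_open (cu j) cu0 (sm (cu i)) Ux.
have Hg a := is_derive_upd x a (x a).
have HS a := is_derive_smooth a (sm (cs i)) Ux.
have Hf p := is_derive_df Fs p i.
have HK b c := is_derive_K (cu i) b c Ux.
have D a b : pd (pd (pd h (cu i)) a) b x = sign eps i * (basis b cu0 * basis a (cu i)
    - df F 1 i (x (cu i)) * basis b (cu i) * basis a cu0) * pd h (cs i) x - dK (cu i) a b x.
  apply: (pd_on U_open (fun y Uy => hessian_cu a i Uy) Ux).
  apply: is_derive_eqR; first by derive_tac.
  by rewrite /= !upd_id hessian_cs //; ring.
rewrite !D !basis_val /coef_a (eq_sym i j); case: eqP => [->|_] E; last by lra.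
move: E; set q := pd h (cs i) x; set s := sign eps i; set f := df F 1 i _.
by move=> E; ring_simplify in E; ring_simplify; lra.
Qed.

End Hessian.

(** * Local isometries *)

Section LocalIsometry.
Variables (k : nat) (eps : nat -> R) (F : nat -> R -> R).
Hypothesis k_gt0 : (0 < k)%N.
Hypothesis eps_signs : signs k eps.
Hypothesis F_adm : admissible k F.
Local Notation I := 'I_(dimF k).
Local Notation V := (vec (dimF k)).
Local Notation cu0 := (cu0 k).
Local Notation cu := (cu k).
Local Notation cv0 := (cv0 k).
Local Notation cv := (cv k).
Local Notation cs := (cs k).
Local Notation gform_F := (gform_F eps F).
Local Notation chris := (chris eps F).
Variables (U : V -> Prop) (phi : V -> V).
Hypothesis U_open : Defs.open_set U.
Hypothesis phi_smooth : smooth_map_on U phi.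

Definition jac (a : I) (x : V) : V := fun c => pd (fun z => phi z c) a x.
Definition hess (a b : I) (x : V) : V := fun c => pd (pd (fun z => phi z c) a) b x.

Hypothesis phi_isom : forall x a b, U x ->
  gform_F (phi x) (jac a x) (jac b x) = gform_F x (basis a) (basis b).

Let Fs := admissible_smooth F_adm.

Lemma is_derive_phi x a c : U x ->
  is_derive (fun t => phi (upd x a t) c) (x a) (jac a x c).
Proof. by move=> Ux; apply: (is_derive_smooth a (phi_smooth c) Ux). Qed.

Lemma is_derive_jac x a b c : U x ->
  is_derive (fun t => jac a (upd x b t) c) (x b) (hess a b x c).
Proof.
by move=> Ux; apply: (is_derive_smooth b (smooth_pd a (phi_smooth c)) Ux).
Qed.

Lemma hess_sym x a b : U x -> hess a b x = hess b a x.
Proof.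
move=> Ux; apply: functional_extensionality => c.
exact: (pd_comm U_open a b (phi_smooth c) Ux).
Qed.

Lemma dgform_F_isom x a b c : U x ->
  dgform_F F x (basis c) (basis a) (basis b) =
  dgform_F F (phi x) (jac c x) (jac a x) (jac b x) + gform_F (phi x) (hess a c x) (jac b x)
  + gform_F (phi x) (jac a x) (hess b c x).
Proof.
move=> Ux.
have := is_derive_gform_F eps Fs (fun c' => is_derive_phi c c' Ux)
  (fun c' => is_derive_jac a c c' Ux) (fun c' => is_derive_jac b c c' Ux).
rewrite upd_id => /is_derive_unique <-; apply/esym.
rewrite -(pd_gF eps Fs); apply: Derive_ext_loc.
apply: filter_imp (locally_upd U_open c Ux) => t Ut.
by rewrite phi_isom // gFE.
Qed.

Definition dphi (x w : V) : V := fun e => rsum (fun h => w h * jac h x e).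

Lemma gform_F_dphi x w c : U x -> gform_F (phi x) (dphi x w) (jac c x) = gform_F x w (basis c).
Proof.
move=> Ux; rewrite (lin_gform_Fl eps F x (basis c) w) (lin_gform_Fl eps F (phi x) (jac c x) _) /dphi.
transitivity (rsum (fun a => rsum (fun h =>
    w h * (jac h x a * gform_F (phi x) (basis a) (jac c x))))).
  by apply: rsum_ext => a; rewrite -rsum_mulr; apply: rsum_ext => h; ring.
rewrite rsum_swap; apply: rsum_ext => h.
by rewrite rsum_mull -(lin_gform_Fl eps F (phi x) (jac c x) (jac h x)) phi_isom.
Qed.

(** The isometry equation is J G J^T = g in matrix form, so invertibility of g forces that of the
    Jacobian J. *)
Lemma jac_nondegenerate x z : U x -> (forall c, gform_F (phi x) z (jac c x) = 0) -> z = fun=> 0.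
Proof.
move=> Ux E.
pose G := gmat (gF k eps F) (phi x); pose j : 'M[R]_(dimF k) := (\matrix_(a, c) jac a x c)%R.
pose zr : 'rV[R]_(dimF k) := (\row_c z c)%R.
have GE (v w : V) : rsum (fun b => rsum (fun a => v a * G a b) * w b) = gform_F (phi x) v w.
  rewrite (lin_gform_Fr eps F (phi x) v w); apply: rsum_ext => b.
  rewrite Rmult_comm (lin_gform_Fl eps F (phi x) (basis b) v); congr (_ * _).
  by apply: rsum_ext => a; rewrite mxE gFE.
have jG : (j *m G *m j^T)%R = gmat (gF k eps F) x.
  apply/matrixP => a b; rewrite mxE [RHS]mxE gFE -phi_isom // -GE.
  by apply: eq_bigr => c _; rewrite !mxE; congr (_ * _); apply: eq_bigr => d _; rewrite mxE.
have ju : j \in unitmx.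
  have := gF_unit F eps_signs x; rewrite -jG !unitmx_mul.
  by case/andP => /andP [].
have zG : (zr *m G *m j^T)%R = 0%R.
  apply/rowP => c; rewrite mxE [RHS]mxE -[RHS](E c) -GE.
  by apply: eq_bigr => b _; rewrite !mxE; congr (_ * _); apply: eq_bigr => d _; rewrite mxE.
have z0 : zr = 0%R.
  have jt : (j^T)%R \in unitmx by rewrite unitmx_tr.
  have Gu : G \in unitmx := gF_unit F eps_signs (phi x).
  by rewrite -[zr](mulmxK Gu) -[(zr *m G)%R](mulmxK jt) zG !mul0mx.
apply: functional_extensionality => c.
by have := congr1 (fun A : 'rV[R]_(dimF k) => A ord0 c) z0; rewrite !mxE.
Qed.

(** The transformation law of Christoffel symbols. The Koszul formula at x and at [phi x], combined
    with the differentiated isometry equation, shows that the difference z of the two sides is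
    orthogonal to all [jac c x]. *)
Lemma hessian_phi x a b e : U x ->
  hess a b x e = rsum (fun c => chris x (basis a) (basis b) c * jac c x e)
              - chris (phi x) (jac a x) (jac b x) e.
Proof.
move=> Ux.
pose z : V := fun e => (hess a b x e + chris (phi x) (jac a x) (jac b x) e)
  + -1 * dphi x (chris x (basis a) (basis b)) e.
suff : z e = 0 by rewrite /z /dphi; lra.
rewrite (@jac_nondegenerate x z) // => c.
have L := lin_gform_Fl eps F (phi x) (jac c x).
rewrite /z (lin_addv _ _ L) (lin_addv _ _ L).
have -> : gform_F (phi x) (fun e => -1 * dphi x (chris x (basis a) (basis b)) e) (jac c x)
   = - gform_F x (chris x (basis a) (basis b)) (basis c).
  rewrite -gform_F_dphi // (L (fun e => _)) (L (dphi _ _)).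
  by rewrite (_ : forall y, - y = -1 * y); [rewrite -rsum_mull; apply: rsum_ext => h; ring | move=> y; ring].
rewrite -!(koszul_gF F eps_signs) !dgform_F_isom // (hess_sym b a) // (hess_sym c a) // (hess_sym c b) //.
rewrite (gform_F_sym _ _ _ (jac b x) (hess a c x)) (gform_F_sym _ _ _ (jac a x) (hess b c x)).
by field.
Qed.

Definition is_cu (a : I) : Prop := a = cu0 \/ exists i : 'I_k, a = cu i.

(** The target Christoffel field has no u-components, so the Hessian equation holds with K = 0. Its
    integrability conditions kill the v- and s-derivatives of a u-component of [phi], and then the
    whole right-hand side, since Christoffel fields of the source have only v- and s-components. *)
Lemma u_affine (e : I) : is_cu e ->
  (forall x a b, U x -> hess a b x e = 0) /\
  (forall x a, U x -> ~ is_cu a -> jac a x e = 0).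
Proof.
move=> ue.
have GG0e x v w : chris x v w e = 0.
  by case: ue => [->|[i ->]]; rewrite /chris vs_vecE.
have hes x a b : U x -> pd (pd (fun z => phi z e) a) b x =
    rsum (fun c => chris x (basis a) (basis b) c * pd (fun z => phi z e) c x) - 0.
  by move=> Ux; have := hessian_phi a b e Ux; rewrite GG0e.
have dK0 (x : V) (a b c : I) : U x -> is_derive (fun _ : R => 0) (x c) 0.
  by move=> _; apply: is_derive_cstR.
pose K (a b : I) (x : V) := 0.
pose dK (a b c : I) (x : V) := 0.
have K1 (x : V) (a b : I) : U x -> a <> cu0 -> (forall i : 'I_k, a <> cu i) -> K a b x = 0 by [].
have dKS (x : V) (j : 'I_k) : U x -> dK (cu j) (cu j) (cs j) x = 0 by [].
have JY0 x : U x -> jac cv0 x e = 0.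
  move=> Ux; exact: (pd_cv0_eq0 F_adm U_open (phi_smooth e) hes K1 dK0 dKS k_gt0 Ux).
have JY x (i : 'I_k) : U x -> jac (cv i) x e = 0.
  move=> Ux; exact: (pd_cv_eq0 F_adm U_open (phi_smooth e) hes K1 i Ux).
have JS x (i : 'I_k) : U x -> jac (cs i) x e = 0.
  move=> Ux.
  have := (integrability F_adm U_open (phi_smooth e) hes K1 dK0 dKS k_gt0 i i Ux).
  rewrite eqxx /dK Rminus_diag => /Rmult_integral [/Rmult_integral []|] //.
    by move/(sign_neq0 eps_signs).
  by move/(@coef_a0_neq0 k F i _ F_adm).
have Jn x a : U x -> ~ is_cu a -> jac a x e = 0.
  move=> Ux; case: (indexP a) => [|i||i|i] nu; [ | | |exact: JY|exact: JS].
  - by case: nu; left.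
  - by case: nu; right; exists i.
  - exact: JY0.
split=> // x a b Ux; rewrite hessian_phi // GG0e rsum_index.
rewrite JY0 // rsum_zero => [|i]; first by rewrite /chris vs_vecE; ring.
by rewrite JY // JS // /chris vs_vecE; ring.
Qed.

Lemma not_is_cu a : a <> cu0 -> (forall i : 'I_k, a <> cu i) -> ~ is_cu a.
Proof. by move=> a0 aX [|[i]] // /aX. Qed.

Lemma is_cu_cu (i : 'I_k) : is_cu (cu i). Proof. by right; exists i. Qed.
Lemma is_cu_cu0 : is_cu cu0. Proof. by left. Qed.

Lemma not_is_cu_cs (j : 'I_k) : ~ is_cu (cs j).
Proof.
case=> [|[i]] /(congr1 val); rewrite /= !vals; first by lia.
by have ? := ltn_ord i; lia.
Qed.

Local Notation K i := (fun a b x => chris_s eps F (phi x) (jac a x) (jac b x) i).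
Local Notation dK i := (fun a b c x =>
  sign eps i * (jac c x cu0 * (jac a x (cu i) * jac b x (cu i))
    - df F 1 i (phi x (cu i)) * jac c x (cu i)
       * (jac a x cu0 * jac b x (cu i) + jac a x (cu i) * jac b x cu0))).

(** These are the hypotheses of the Hessian equation for an s-component of [phi]. By [u_affine] the
    second derivatives of the u-components drop out of the derivative of K, and K involves no s- or
    v-directions. *)
Lemma s_equation (i : 'I_k) :
  [/\ forall x a b, U x -> pd (pd (fun z => phi z (cs i)) a) b x =
        rsum (fun c => chris x (basis a) (basis b) c * pd (fun z => phi z (cs i)) c x)
        - K i a b x,
      forall x a b, U x -> a <> cu0 -> (forall i : 'I_k, a <> cu i) -> K i a b x = 0,
      forall x a b c, U x -> is_derive (fun t => K i a b (upd x c t)) (x c) (dK i a b c x)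
    & forall x (j : 'I_k), U x -> dK i (cu j) (cu j) (cs j) x = 0].
Proof.
split.
- move=> x a b Ux; have := hessian_phi a b (cs i) Ux.
  by rewrite {2}/chris vs_vecE.
- move=> x a b Ux a0 aX; rewrite /chris_s.
  have na := not_is_cu a0 aX.
  rewrite (proj2 (u_affine (is_cu_cu i)) x a Ux na) (proj2 (u_affine is_cu_cu0) x a Ux na).
  by ring.
- move=> x a b c Ux.
  have := is_derive_chris_s eps Fs i (fun c' => is_derive_phi c c' Ux)
    (fun c' => is_derive_jac a c c' Ux) (fun c' => is_derive_jac b c c' Ux).
  rewrite !upd_id => D; apply: is_derive_eqR D _.
  rewrite /chris_s !(proj1 (u_affine (is_cu_cu i))) // !(proj1 (u_affine is_cu_cu0)) //.
  by ring.
- move=> x j Ux.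
  have nS := @not_is_cu_cs j.
  rewrite (proj2 (u_affine (is_cu_cu i)) x _ Ux nS) (proj2 (u_affine is_cu_cu0) x _ Ux nS).
  by ring.
Qed.

Lemma jac_cs_const x (i j : 'I_k) b : U x -> hess (cs j) b x (cs i) = 0.
Proof.
move=> Ux; have [hes K1 HdK dKS] := s_equation i.
exact: (hessian_cs F_adm U_open (phi_smooth (cs i)) hes K1 HdK dKS k_gt0 j b Ux).
Qed.

(** The counterpart of [coefficient_relation] for p = 0: on the right of the integrability condition
    the two derivatives of K combine into the factor 1 + f_i' times a value of [omega]. *)
Lemma isometry_relation0 x (i j j' : 'I_k) : U x ->
  (if j == j' then sign eps j * coef_a F 0 j (x (cu j)) * jac (cs j) x (cs i) else 0) =
  sign eps i * coef_a F 0 i (phi x (cu i)) * omega (jac cu0 x) (jac (cu j) x) i * jac (cu j') x (cu i).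
Proof.
move=> Ux; have [hes K1 HdK dKS] := s_equation i.
have := integrability F_adm U_open (phi_smooth (cs i)) hes K1 HdK dKS k_gt0 j' j Ux.
by move=> ->; rewrite /omega /coef_a; ring.
Qed.

(** Induction by differentiation along u_j. All Jacobian entries involved have zero derivative, so
    only the coefficients are differentiated, and the chain rule on the right supplies one more
    factor d_(u_j) phi^(u_i). *)
Lemma isometry_relation p x (i j : 'I_k) : U x ->
  sign eps j * coef_a F p j (x (cu j)) * jac (cs j) x (cs i) =
  sign eps i * coef_a F p i (phi x (cu i)) * omega (jac cu0 x) (jac (cu j) x) i * jac (cu j) x (cu i) ^ p.+1.
Proof.
elim: p x => [|p IH] x Ux.
  by have := isometry_relation0 i j j Ux; rewrite eqxx => ->; rewrite /= Rmult_1_r.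
have Hg a := is_derive_upd x a (x a).
have HA q h := is_derive_coef_a Fs q h.
have HJ a := is_derive_jac a (cu j) (cs i) Ux.
have HX a := is_derive_jac a (cu j) (cu i) Ux.
have H0 a := is_derive_jac a (cu j) cu0 Ux.
have Hp a c := is_derive_phi a c Ux.
have D1 : pd (fun y => sign eps j * coef_a F p j (y (cu j)) * jac (cs j) y (cs i)) (cu j) x =
    sign eps j * coef_a F p.+1 j (x (cu j)) * jac (cs j) x (cs i).
  apply: pd_derive; apply: is_derive_eqR; first by derive_tac.
  by rewrite /= !upd_id jac_cs_const // !basis_val eqxx; ring.
rewrite -D1; apply: (pd_on U_open IH Ux).
rewrite /omega; apply: is_derive_eqR.
  by repeat (derive_tac; try apply: is_derive_pow).
have [HX0 _] := u_affine (is_cu_cu i); have [H00 _] := u_affine is_cu_cu0.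
by rewrite /= !upd_id !HX0 // !H00 //; ring.
Qed.
Lemma isometry_beta (l : nat) x : (0 < l)%N -> U x -> beta k F l x = beta k F l (phi x).
Proof.
move=> l0 Ux.
(* The image of d_(s_j) has no u-components, so its nonzero square length comes from its
   s-components. *)
have ex (j : 'I_k) : exists i : 'I_k, jac (cs j) x (cs i) <> 0.
  case: (boolP [forall i : 'I_k, jac (cs j) x (cs i) == 0]) => [/forallP Z|].
    exfalso; have := phi_isom (cs j) (cs j) Ux; rewrite gform_F_cs !basis_val eqxx.
    have u0 := proj2 (u_affine is_cu_cu0) x _ Ux (@not_is_cu_cs j).
    have uX i := proj2 (u_affine (is_cu_cu i)) x _ Ux (@not_is_cu_cs j).
    rewrite /gform_F u0 rsum_zero => [|i].
      by move=> E; apply: (sign_neq0 eps_signs (i := j)); rewrite -[LHS]Rmult_1_r -E; ring.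
    by rewrite /gform_F_term u0 uX (eqP (Z i)); ring.
  by case/forallPn => i /eqP; exists i.
have [s Hs] := fin_all_exists ex.
have rhs (j : 'I_k) :
    sign eps j * coef_a F 0 j (x (cu j)) * jac (cs j) x (cs (s j)) <> 0.
  move=> /Rmult_integral [/Rmult_integral []|].
  - exact: sign_neq0.
  - exact: (@coef_a0_neq0 k F j _ F_adm).
  - exact: Hs.
(* For i different from j the relation makes a product of an [omega] factor and a Jacobian factor
   vanish. If s i = s j, the first being zero contradicts the diagonal relation for i, the second
   the one for j. *)
have s_inj : injective s.
  move=> i j sij; apply/eqP; apply: contraT => /negbTE ne; exfalso.
  have := isometry_relation0 (s i) i j Ux; rewrite ne => /esym /Rmult_integral [z|z].
    by apply: (rhs i); have := isometry_relation0 (s i) i i Ux; rewrite eqxx z Rmult_0_l.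
  by apply: (rhs j); have := isometry_relation0 (s j) j j Ux; rewrite eqxx -sij z Rmult_0_r.
(* The equality is reversed because here the coefficients at [phi x] are the a's of [beta_ratio] and
   those at x the b's. *)
apply: (beta_eq_of_matching (s := s)) => // j; apply/esym.
have rel p : coef_a F p j (x (cu j)) * (sign eps j * jac (cs j) x (cs (s j))) =
    coef_a F p (s j) (phi x (cu (s j)))
    * ((sign eps (s j) * omega (jac cu0 x) (jac (cu j) x) (s j)) * jac (cu j) x (cu (s j)))
    * jac (cu j) x (cu (s j)) ^ p.
  by have := isometry_relation p (s j) j Ux; rewrite /= => E; lra.
have := rel 0%N; rewrite /= Rmult_1_r => rel0.
have := rel 1%N; rewrite /= Rmult_1_r => rel1.
apply: (beta_ratio l0 _ _ _ rel0 rel1 (rel l)).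
- by move=> /Rmult_integral []; [apply: sign_neq0 | apply: Hs].
- exact: (@coef_a0_neq0 k F j _ F_adm).
- exact: (@coef_a1_neq0 k F (s j) _ F_adm).
Qed.

End LocalIsometry.

Unset Implicit Arguments.

Theorem theorem1p8 (k : nat) (eps : nat -> R) (F : nat -> R -> R) :
  (1 <= k)%N -> signs k eps -> admissible k F ->
  (* (1) beta_l is an l-model invariant *)
  (forall (l : nat) (F' : nat -> R -> R) (P Q : vec (dimF k))
          (M : 'M[R]_(dimF k)),
     (1 <= l)%N -> admissible k F' ->
     model_iso (gF k eps F) (gF k eps F') l P Q M ->
     beta k F l P = beta k F' l Q) /\
  (* (2) l-curvature homogeneous => beta_p constant for p = 1..l *)
  (forall l : nat, (1 <= l)%N -> curv_hom (gF k eps F) l ->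
     forall p : nat, (1 <= p <= l)%N ->
     forall P Q : vec (dimF k), beta k F p P = beta k F p Q) /\
  (* (3) locally homogeneous => all beta_l constant *)
  (loc_hom (gF k eps F) ->
     forall l : nat, (1 <= l)%N ->
     forall P Q : vec (dimF k), beta k F l P = beta k F l Q).
Proof.
move=> k0 He HF; split; [|split].
- by move=> l F' P Q M l0 HF'; apply: model_iso_beta.
- move=> l _ hom p /andP [p0 pl] P Q; have [M [Mu [Mg MR]]] := hom P Q.
  (* An isomorphism of l-models is also one of p-models for p at most l. *)
  apply: (@model_iso_beta k eps F F p P Q M) => //; split=> //; split=> // i ip.
  by apply: MR; apply: leq_trans pl.
- move=> hom l l0 P Q.
  have [U [_ [phi [_ [U_open [_ [UP [<- [_ [_ [phi_smooth [_ isom]]]]]]]]]]]] := hom P Q.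
  apply: (isometry_beta k0 He HF U_open phi_smooth _ l0 UP) => x a b Ux.
  by rewrite -gFE -isom // -gformE.
Qed.
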